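(* Let $(\mathcal C,\alpha)$ be a grading category, $A$ a $\mathcal C$-graded algebra and $M$ a $\mathcal C$-graded $(A,A)$-bimodule. Then for every $n\ge0$ $$\mathrm{Hom}_{\mathrm{Bim}(I_{\mathcal C},I_{\mathcal C})^{\mathcal C}}(A^{\otimes n},M)\cong\mathrm{Hom}_{\mathrm{Bim}(A,A)^{\mathcal C}}(A^{\otimes n+2},M)$$ (as $\Bbbk$-modules), where $A^{\otimes0}=I_{\mathcal C}$.
   Context: Let $\Bbbk$ be a commutative unital ring with unit group $\Bbbk^\times$ and $\mathcal C$ a small category. A grading category $(\mathcal C,\alpha)$: $\alpha$ assigns to each composable triple $(f_1,f_2,f_3)$ (so $f_3\circ f_2\circ f_1$ is defined) an element of $\Bbbk^\times$ such that for all composable $(f_1,f_2,f_3,f_4)$: $\alpha(f_1,f_2,f_3)\,\alpha(f_1,f_2,f_4\circ f_3)^{-1}\alpha(f_1,f_3\circ f_2,f_4)\,\alpha(f_2\circ f_1,f_3,f_4)^{-1}\alpha(f_2,f_3,f_4)=1$. A $\mathcal C$-graded module is a $\Bbbk$-module $M=\bigoplus_{g\in\mathrm{Mor}(\mathcal C)}M_g$; write $|x|=g$ for $x\in M_g$. Graded maps are $\Bbbk$-linear and preserve each $M_g$. $(M\otimes N)_g=\bigoplus_{g=g_2\circ g_1}M_{g_1}\otimes_\Bbbk N_{g_2}$ (products of elements with non-composable degrees are zero). Unit object $I_{\mathcal C}=\bigoplus_{X\in\mathrm{Ob}(\mathcal C)}\Bbbk_{\mathrm{Id}_X}$ ($\Bbbk$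 placed in degree $\mathrm{Id}_X$), an algebra by multiplication of scalars in each summand. Typical unitor constants (assumed): for $g:X\to Y$, $\mathcal L(\mathrm{Id}_X,g)=\alpha(\mathrm{Id}_X,\mathrm{Id}_X,g)^{-1}$, $\mathcal R(g,\mathrm{Id}_Y)=\alpha(g,\mathrm{Id}_Y,\mathrm{Id}_Y)$. A $\mathcal C$-graded algebra is a $\mathcal C$-graded module $A$ with a graded $\Bbbk$-linear $\mu:A\otimes A\to A$ (so $|\mu(x,y)|=|y|\circ|x|$) and elements $1_X\in A_{\mathrm{Id}_X}$ with, for homogeneous elements, $\mu(\mu(x,y),z)=\alpha(|x|,|y|,|z|)\mu(x,\mu(y,z))$, $\mu(1_X,x)=\mathcal L(\mathrm{Id}_X,|x|)x$, $\mu(x,1_Y)=\mathcal R(|x|,\mathrm{Id}_Y)x$ if $|x|:X\to Y$. A $\mathcal C$-graded $(A,B)$-bimodule is a $\mathcal C$-graded module $M$ with graded maps $\rho_L:A\otimes M\to M$, $\rho_R:M\otimes B\to M$ such that $\rho_L(\mu_A(a,a'),m)=\alpha(|a|,|a'|,|m|)\rho_L(a,\rho_L(a',m))$, $\rho_R(\rho_R(m,b),b')=\alpha(|m|,|b|,|b'|)\rho_R(m,\mu_B(b,b'))$, $\rho_R(\rho_L(a,m),b)=\alpha(|a|,|m|,|b|)\rho_L(a,\rho_R(m,b))$, $\rho_L(1_X,m)=\mathcal L(\mathrm{Id}_X,|m|)m$, $\rho_R(m,1_Y)=\mathcal R(|m|,\mathrm{Id}_Y)m$ for $|m|:X\to Y$.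 $\mathrm{Bim}(A,B)^{\mathcal C}$ is the category of these with graded maps commuting with both actions. A $\mathcal C$-graded $(I_{\mathcal C},I_{\mathcal C})$-bimodule is just a $\mathcal C$-graded module (the actions being given by the unitors), and morphisms in $\mathrm{Bim}(I_{\mathcal C},I_{\mathcal C})^{\mathcal C}$ are graded maps. $A^{\otimes n+2}$ (parenthesized to the left) is a $\mathcal C$-graded $(A,A)$-bimodule via $\rho_L(a,a_0\otimes\cdots\otimes a_{n+1})=\prod_{i=1}^{n+1}\alpha(|a|,|a_{i-1}|\circ\cdots\circ|a_0|,|a_i|)^{-1}\,\mu(a,a_0)\otimes a_1\otimes\cdots\otimes a_{n+1}$ and $\rho_R(a_0\otimes\cdots\otimes a_{n+1},a)=\alpha(|a_n|\circ\cdots\circ|a_0|,|a_{n+1}|,|a|)\,a_0\otimes\cdots\otimes a_n\otimes\mu(a_{n+1},a)$. *)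

(* Defs.v *)
From HB Require Import structures.
From mathcomp Require Import all_boot all_algebra finmap.
From mathcomp Require Import boolp classical_sets functions.
From mathcomp Require Import cardinality fsbigop.
From mathcomp Require Import ring.

Set Implicit Arguments.
Unset Strict Implicit.
Unset Printing Implicit Defensive.

Import GRing.Theory.
Local Open Scope classical_set_scope.
Local Open Scope ring_scope.

Section LinearMaps.
Variable k : comPzRingType.

Definition mk_linear (U V : lmodType k) (f : U -> V) (lf : linear f) :
  {linear U -> V} :=
  HB.pack f (GRing.isLinear.Build k U V *:%R f lf).

Lemma mk_linearE (U V : lmodType k) (f : U -> V) (lf : linear f) :
  mk_linear lf =1 f.
Proof. by []. Qed.

Lemma linear_eq (U V : lmodType k) (f g : {linear U -> V}) : f =1 g -> f = g.
Proof.
case: f g => [f [[[f0 fD]] [fZ]]] [g [[[g0 gD]] [gZ]]] /= /funext e.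
move: e f0 fD fZ g0 gD gZ => /= -> *.
by do 2 f_equal; f_equal; exact: Prop_irrelevance.
Qed.

Definition bilin (U V W : lmodType k) (b : U -> V -> W) : Prop :=
  (forall v, linear (b^~ v)) /\ (forall u, linear (b u)).

End LinearMaps.

Section DirectSum.
Variables (k : comPzRingType) (I : choiceType) (V : I -> lmodType k).

Record dsum := Dsum {
  dval :> forall i, V i;
  dval_fin : finite_set [set i | dval i != 0] }.

HB.instance Definition _ := gen_eqMixin dsum.
HB.instance Definition _ := gen_choiceMixin dsum.

Lemma dsumP (u v : dsum) : (forall i, u i = v i) -> u = v.
Proof.
case: u v => [u fu] [v fv] /= e.
have {}e : u = v by apply: functional_extensionality_dep.
by move: fu fv; rewrite e => fu fv; congr Dsum; exact: Prop_irrelevance.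
Qed.

Lemma dsum0_fin : finite_set [set i | (0 : V i) != 0].
Proof. by apply: (@sub_finite_set _ _ set0) => // i /=; rewrite eqxx. Qed.

Lemma dsumD_fin (u v : dsum) : finite_set [set i | u i + v i != 0].
Proof.
apply: (@sub_finite_set _ _ ([set i | u i != 0] `|` [set i | v i != 0])).
  move=> i /= uv; have [u0|] := eqVneq (u i) 0; last by left.
  by right; apply: contraNneq uv => ->; rewrite u0 addr0.
by rewrite finite_setU; split; exact: dval_fin.
Qed.

Lemma dsumN_fin (u : dsum) : finite_set [set i | - u i != 0].
Proof.
by apply: sub_finite_set (dval_fin u) => i /=; rewrite oppr_eq0.
Qed.

Lemma dsumZ_fin (a : k) (u : dsum) : finite_set [set i | a *: u i != 0].
Proof.
apply: sub_finite_set (dval_fin u) => i /=.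
by apply: contraNneq => ->; rewrite scaler0.
Qed.

Definition dsum0 := Dsum dsum0_fin.
Definition dsumD u v := Dsum (dsumD_fin u v).
Definition dsumN u := Dsum (dsumN_fin u).
Definition dsumZ a u := Dsum (dsumZ_fin a u).

Lemma dsumDA : associative dsumD.
Proof. by move=> u v w; apply: dsumP => i /=; rewrite addrA. Qed.
Lemma dsumDC : commutative dsumD.
Proof. by move=> u v; apply: dsumP => i /=; rewrite addrC. Qed.
Lemma dsum0D : left_id dsum0 dsumD.
Proof. by move=> u; apply: dsumP => i /=; rewrite add0r. Qed.
Lemma dsumND : left_inverse dsum0 dsumN dsumD.
Proof. by move=> u; apply: dsumP => i /=; rewrite addNr. Qed.

HB.instance Definition _ :=
  GRing.isZmodule.Build dsum dsumDA dsumDC dsum0D dsumND.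

Lemma dsumZA a b (u : dsum) : dsumZ a (dsumZ b u) = dsumZ (a * b) u.
Proof. by apply: dsumP => i /=; rewrite scalerA. Qed.
Lemma dsumZ1 : left_id 1 dsumZ.
Proof. by move=> u; apply: dsumP => i /=; rewrite scale1r. Qed.
Lemma dsumZDr : right_distributive dsumZ +%R.
Proof. by move=> a u v; apply: dsumP => i /=; rewrite scalerDr. Qed.
Lemma dsumZDl (u : dsum) : {morph dsumZ^~ u : a b / a + b}.
Proof. by move=> a b; apply: dsumP => i /=; rewrite scalerDl. Qed.

HB.instance Definition _ :=
  GRing.Zmodule_isLmodule.Build k dsum dsumZA dsumZ1 dsumZDr dsumZDl.

Lemma dsum0E i : (0 : dsum) i = 0. Proof. by []. Qed.
Lemma dsumDE (u v : dsum) i : (u + v) i = u i + v i. Proof. by []. Qed.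
Lemma dsumZE a (u : dsum) i : (a *: u) i = a *: u i. Proof. by []. Qed.
Lemma dsum_sumE (J : Type) (r : seq J) (F : J -> dsum) i :
  (\sum_(j <- r) F j) i = \sum_(j <- r) F j i.
Proof. by elim: r => [|j r IH]; rewrite ?big_nil// !big_cons dsumDE IH. Qed.

Lemma dinj_fin i (x : V i) :
  finite_set [set j | dfwith (fun j => 0 : V j) x j != 0].
Proof.
apply: (@sub_finite_set _ _ [set i]) => // j /=.
by case: dfwithP => // j' _; rewrite eqxx.
Qed.

Definition dinj i (x : V i) : dsum := Dsum (dinj_fin x).

Lemma dinj_linear i : linear (@dinj i).
Proof.
move=> a x y; apply: dsumP => j; rewrite dsumDE dsumZE /=.
have [<-|ij] := eqVneq i j; first by rewrite !dfwith_in.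
by rewrite !dfwith_out// scaler0 addr0.
Qed.

HB.instance Definition _ i :=
  GRing.isLinear.Build k (V i) dsum *:%R (@dinj i) (@dinj_linear i).

Definition dsupp (u : dsum) : {fset I} := fset_set [set i | u i != 0].

Lemma dsuppP (u : dsum) i : i \notin dsupp u -> u i = 0.
Proof.
by rewrite /dsupp in_fset_set ?notin_setE /= => [/negP/negPn/eqP|]; last exact: dval_fin.
Qed.

Lemma dsum_decomp (u : dsum) : u = \sum_(i <- dsupp u) dinj (u i).
Proof.
apply: dsumP => i; rewrite dsum_sumE.
have [iu|iu] := boolP (i \in dsupp u); last first.
  rewrite dsuppP// big_seq big1// => j ju /=.
  by rewrite dfwith_out//; apply: contraNneq iu => <-.
rewrite (bigD1_seq i)//= dfwith_in big1 ?addr0// => j ji.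
by rewrite dfwith_out.
Qed.

Section Elim.
Variables (W : lmodType k) (phi : forall i, {linear V i -> W}).

Definition dsum_elim (u : dsum) : W := \sum_(i \in [set: I]) phi i (u i).

Lemma dsum_elim_seq (u : dsum) (r : {fset I}) :
  (forall i, i \notin r -> u i = 0) ->
  dsum_elim u = \sum_(i <- r) phi i (u i).
Proof.
move=> ur; rewrite /dsum_elim -(@fsbig_widen _ _ _ _ [set` r])//.
  by rewrite -fsbig_seq ?fset_uniq.
by move=> i [_ /= /negP ir]; rewrite ur// raddf0.
Qed.

Lemma dsum_elim_linear : linear dsum_elim.
Proof.
move=> a u v; set r := (dsupp u `|` dsupp v)%fset.
have ur i : i \notin r -> u i = 0.
  by rewrite inE negb_or => /andP[/dsuppP].
have vr i : i \notin r -> v i = 0.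
  by rewrite inE negb_or => /andP[_ /dsuppP].
rewrite (dsum_elim_seq ur) (dsum_elim_seq vr) (@dsum_elim_seq _ r).
  by rewrite scaler_sumr -big_split; apply: eq_bigr => i _; rewrite linearP.
by move=> i ir; rewrite dsumDE dsumZE ur// vr// scaler0 addr0.
Qed.

HB.instance Definition _ :=
  GRing.isLinear.Build k dsum W *:%R dsum_elim dsum_elim_linear.

Lemma dsum_elim_inj i (x : V i) : dsum_elim (dinj x) = phi i x.
Proof.
rewrite (@dsum_elim_seq _ [fset i]%fset) ?big_seq_fset1/= ?dfwith_in// => j.
by rewrite inE => ij; rewrite /= dfwith_out// eq_sym.
Qed.

End Elim.

Lemma dsum_ext (W : lmodType k) (f g : {linear dsum -> W}) :
  (forall i x, f (@dinj i x) = g (@dinj i x)) -> f =1 g.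
Proof.
move=> fg u; rewrite (dsum_decomp u) !raddf_sum.
by apply: eq_bigr => i _; exact: fg.
Qed.

End DirectSum.

Section QuotientModule.
Variables (k : comPzRingType) (V : lmodType k) (S : set V).

Inductive span : set V :=
| span0 : span 0
| spanZD a x y of S x & span y : span (a *: x + y).

Definition spanp : {pred V} := [pred x | `[< span x >]].

Lemma spanpE x : (x \in spanp) = `[< span x >]. Proof. by []. Qed.

Lemma span_submod : submod_closed spanp.
Proof.
split=> [|a x y /asboolP sx /asboolP sy]; apply/asboolP; first exact: span0.
elim: sx => [|b u v Su _ IH]; first by rewrite scaler0 add0r.
by rewrite scalerDr scalerA -addrA; exact: spanZD.
Qed.

HB.instance Definition _ := GRing.isSubmodClosed.Build k V spanp span_submod.

Definition quotmod := Quotient.quot spanp.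

HB.instance Definition _ := GRing.Zmodule.on quotmod.

Definition qproj (x : V) : quotmod := (\pi_(Quotient.quot spanp) x)%qT.

Lemma qprojP x y : (qproj x = qproj y) <-> span (x - y).
Proof.
split=> [/eqP|s]; last apply/eqP.
  by rewrite /qproj -Quotient.idealrBE => /asboolP.
by rewrite /qproj -Quotient.idealrBE; exact/asboolP.
Qed.

Lemma qprojD : {morph qproj : x y / x + y}.
Proof. by move=> x y; rewrite /qproj Quotient.pi_add. Qed.

Lemma qprojK (x : quotmod) : qproj (repr x) = x.
Proof. exact: reprK. Qed.

Definition quotZ (a : k) (x : quotmod) : quotmod := qproj (a *: repr x).

Lemma quotZE a x : quotZ a (qproj x) = qproj (a *: x).
Proof.
apply/qprojP; rewrite -scalerBr.
have /qprojP/asboolP h := qprojK (qproj x).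
by apply/asboolP; rewrite -spanpE rpredZ.
Qed.

Lemma quotZA a b u : quotZ a (quotZ b u) = quotZ (a * b) u.
Proof. by rewrite -(qprojK u) !quotZE scalerA. Qed.
Lemma quotZ1 : left_id 1 quotZ.
Proof. by move=> u; rewrite -(qprojK u) quotZE scale1r. Qed.
Lemma quotZDr : right_distributive quotZ +%R.
Proof.
move=> a u v; rewrite -(qprojK u) -(qprojK v) -qprojD !quotZE.
by rewrite scalerDr qprojD.
Qed.
Lemma quotZDl u : {morph quotZ^~ u : a b / a + b}.
Proof. by move=> a b; rewrite -(qprojK u) !quotZE scalerDl qprojD. Qed.

HB.instance Definition _ :=
  GRing.Zmodule_isLmodule.Build k quotmod quotZA quotZ1 quotZDr quotZDl.

Lemma qproj_linear : linear qproj.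
Proof. by move=> a x y; rewrite qprojD -quotZE. Qed.

HB.instance Definition _ :=
  GRing.isLinear.Build k V quotmod *:%R qproj qproj_linear.

Section Elim.
Variables (W : lmodType k) (f : {linear V -> W}).
Hypothesis fS : forall x, S x -> f x = 0.

Definition quot_elim (u : quotmod) : W := f (repr u).

Lemma quot_elim_proj x : quot_elim (qproj x) = f x.
Proof.
have /qprojP := qprojK (qproj x); rewrite /quot_elim.
set d := _ - _ => sd; suff: f d = 0 by rewrite raddfB => /subr0_eq.
by elim: sd => [|a u v Su _ IH]; rewrite ?raddf0// linearP fS// scaler0 IH addr0.
Qed.

Lemma quot_elim_linear : linear quot_elim.
Proof.
move=> a u v; rewrite -(qprojK u) -(qprojK v) -linearP !quot_elim_proj.
exact: linearP.
Qed.

End Elim.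
End QuotientModule.

Section Tensor.
Variables (k : comPzRingType) (U V : lmodType k).

Definition free_mod (T : choiceType) : lmodType k := dsum (fun _ : T => k^o).
Definition free_gen (T : choiceType) (t : T) : free_mod T :=
  @dinj k T (fun=> k^o) t 1.

Local Notation gen u v := (@free_gen (U * V)%type (u, v)).

Inductive tensor_rel : set (free_mod (U * V)%type) :=
| tensor_rel_l a u u' v :
    tensor_rel (gen (a *: u + u') v - (a *: gen u v + gen u' v))
| tensor_rel_r a u v v' :
    tensor_rel (gen u (a *: v + v') - (a *: gen u v + gen u v')).

Definition tensor : lmodType k := quotmod tensor_rel.

Definition tens (u : U) (v : V) : tensor := qproj tensor_rel (gen u v).

Lemma tens_bilin : bilin tens.
Proof.
by split=> [v a u u'|u a v v']; rewrite /tens -linearP; apply/qprojP;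
  rewrite -[X in span _ X]addr0 -[X in X + 0]scale1r; apply: spanZD;
  constructor.
Qed.

Section Elim.
Variables (W : lmodType k) (b : U -> V -> W) (bb : bilin b).

Lemma scale_to_linear (w : W) : linear (fun a : k^o => a *: w).
Proof. by move=> a x y; rewrite scalerDl scalerA. Qed.

Definition free_elim : {linear free_mod (U * V)%type -> W} :=
  @dsum_elim _ _ _ W (fun p => mk_linear (scale_to_linear (b p.1 p.2))).

Lemma free_elimE u v : free_elim (gen u v) = b u v.
Proof. by rewrite /free_elim /= dsum_elim_inj /= scale1r. Qed.

Lemma free_elim_rel x : tensor_rel x -> free_elim x = 0.
Proof.
case: bb => bl br [a u u' v|a u v v']; rewrite linearB linearP !free_elimE.
  by rewrite bl subrr.
by rewrite br subrr.
Qed.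

Definition tensor_elim : {linear tensor -> W} :=
  mk_linear (quot_elim_linear free_elim_rel).

Lemma tensor_elimE u v : tensor_elim (tens u v) = b u v.
Proof. by rewrite /tensor_elim mk_linearE /tens quot_elim_proj ?free_elimE//; exact: free_elim_rel. Qed.

End Elim.

Lemma tensor_ext (W : lmodType k) (f g : {linear tensor -> W}) :
  (forall u v, f (tens u v) = g (tens u v)) -> f =1 g.
Proof.
move=> fg x; rewrite -(qprojK x); move: (repr x) => {}x.
apply: (@dsum_ext _ _ _ W (f \o qproj tensor_rel) (g \o qproj tensor_rel)).
move=> [u v] a /=.
have -> : @dinj k _ (fun=> k^o) (u, v) a = a *: gen u v.
  by rewrite -(linearZ_LR (@dinj k _ (fun=> k^o) (u, v))) [_ *: _]mulr1.
by rewrite !linearZ_LR; congr (_ *: _); exact: fg.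
Qed.

End Tensor.

Record category := Category {
  obj :> Type;
  hom : obj -> obj -> Type;
  idm : forall X, hom X X;
  comp : forall X Y Z, hom Y Z -> hom X Y -> hom X Z;
  comp1m : forall X Y (f : hom X Y), comp (idm Y) f = f;
  compm1 : forall X Y (f : hom X Y), comp f (idm X) = f;
  compmA : forall W X Y Z (f : hom W X) (g : hom X Y) (h : hom Y Z),
    comp h (comp g f) = comp (comp h g) f }.

Arguments hom {c} X Y.
Arguments idm {c} X.
Arguments comp {c X Y Z} g f.
Notation "g \oc f" := (comp g f) (at level 40, left associativity).

(* The unit group of k.  [GRing.unit] is not available over a [comPzRingType],
   which, unlike a [comUnitRingType], may be the zero ring. *)
Record units (k : comPzRingType) := Units {
  uval : k;
  uinv : k;
  uvalV : uval * uinv = 1 }.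

(* [assoc_coef f1 f2 f3] is the constant attached to the composite f3 o f2 o f1:
   arguments are listed in the order in which the morphisms are applied. *)
Record grading (k : comPzRingType) (C : category) := Grading {
  assoc_coef :> forall W X Y Z : C,
    hom W X -> hom X Y -> hom Y Z -> units k;
  assoc_cocycle : forall (V W X Y Z : C) (f1 : hom V W) (f2 : hom W X)
      (f3 : hom X Y) (f4 : hom Y Z),
    uval (assoc_coef f1 f2 f3) * uinv (assoc_coef f1 f2 (f4 \oc f3))
    * uval (assoc_coef f1 (f3 \oc f2) f4)
    * uinv (assoc_coef (f2 \oc f1) f3 f4) * uval (assoc_coef f2 f3 f4) = 1 }.

Arguments assoc_coef {k C} g {W X Y Z} f1 f2 f3 : rename.

Section GradedModules.
Variables (k : comPzRingType) (C : category).

(* The graded module M = (+)_g M_g is given by the family of its homogeneous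
   components; graded maps then are families of linear maps. *)
Record gmod := GMod { gpart :> forall X Y : C, hom X Y -> lmodType k }.

Record gmap (M N : gmod) := GMap {
  gmap_part :> forall (X Y : C) (f : hom X Y), {linear M X Y f -> N X Y f} }.

Lemma gmap_eq (M N : gmod) (F G : gmap M N) :
  (forall (X Y : C) (f : hom X Y), F X Y f =1 G X Y f) -> F = G.
Proof.
case: F G => [F] [G] /= FG; congr GMap.
apply: functional_extensionality_dep => X.
apply: functional_extensionality_dep => Y.
apply: functional_extensionality_dep => f; apply: linear_eq; exact: FG.
Qed.

Record factorization (X Y : C) (h : hom X Y) := Factorization {
  fmid : C;
  ffst : hom X fmid;
  fsnd : hom fmid Y;
  factorizationE : fsnd \oc ffst = h }.

HB.instance Definition _ (X Y : C) (h : hom X Y) := gen_eqMixin (factorization h).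
HB.instance Definition _ (X Y : C) (h : hom X Y) :=
  gen_choiceMixin (factorization h).

(* (M (x) N)_h is the direct sum of the M_f (x) N_g over the pairs with g o f = h. *)
Definition gtensor (M N : gmod) : gmod := GMod (fun X Y h =>
  dsum (fun F : factorization h => tensor (M _ _ (ffst F)) (N _ _ (fsnd F)))).

(* The homogeneous element x (x) y, for |x| = f and |y| = g.  The degree h is any
   morphism with a proof of g o f = h: this avoids transporting elements along
   the associativity and unit laws of the category. *)
Definition gtens (M N : gmod) (X Y Z : C) (f : hom X Y) (g : hom Y Z)
    (h : hom X Z) (e : g \oc f = h) (x : M _ _ f) (y : N _ _ g) :
    gtensor M N X Z h :=
  @dinj k _ (fun F : factorization h => tensor (M _ _ (ffst F)) (N _ _ (fsnd F)))
    (Factorization e) (tens x y).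

Lemma gtens_bilin (M N : gmod) (X Y Z : C) (f : hom X Y) (g : hom Y Z)
    (h : hom X Z) (e : g \oc f = h) : bilin (@gtens M N _ _ _ f g h e).
Proof.
have [tl tr] := @tens_bilin k (M _ _ f) (N _ _ g).
split=> [y a x x'|x a y y']; rewrite /gtens.
  by rewrite tl linearP.
by rewrite tr linearP.
Qed.

Section Elim.
Variables (M N : gmod) (X Y : C) (h : hom X Y) (W : lmodType k).
Variable b : forall F : factorization h, M _ _ (ffst F) -> N _ _ (fsnd F) -> W.
Arguments b : clear implicits.
Hypothesis bb : forall F, bilin (b F).

Definition gtensor_elim : {linear gtensor M N X Y h -> W} :=
  @dsum_elim _ _ _ W (fun F => tensor_elim (@bb F)).

Lemma gtensor_elimE (Z : C) (f : hom X Z) (g : hom Z Y) (e : g \oc f = h) x y :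
  gtensor_elim (gtens e x y) = b (Factorization e) x y.
Proof. by rewrite /gtensor_elim /gtens /= dsum_elim_inj tensor_elimE. Qed.

End Elim.

Lemma gtensor_ext (M N : gmod) (X Y : C) (h : hom X Y) (W : lmodType k)
    (F G : {linear gtensor M N X Y h -> W}) :
  (forall (Z : C) (f : hom X Z) (g : hom Z Y) (e : g \oc f = h) x y,
     F (gtens e x y) = G (gtens e x y)) -> F =1 G.
Proof.
move=> FG; apply: dsum_ext => -[Z f g e] t.
pose V (F : factorization h) := tensor (M _ _ (ffst F)) (N _ _ (fsnd F)).
pose i : {linear V (Factorization e) -> dsum V} := @dinj k _ V _.
by apply: (@tensor_ext _ _ _ W (F \o i) (G \o i)) => x y; exact: FG.
Qed.

Lemma gtensor_elim_linear (M N : gmod) (X Y : C) (h : hom X Y) (U W : lmodType k)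
    (b : U -> forall F : factorization h,
      M _ _ (ffst F) -> N _ _ (fsnd F) -> W)
    (bb : forall u F, bilin (b u F)) :
  (forall F x y, linear (fun u => b u F x y)) ->
  forall t, linear (fun u => gtensor_elim (bb u) t).
Proof.
move=> bl t a u v /=.
have sl : linear (fun t => a *: gtensor_elim (bb u) t + gtensor_elim (bb v) t).
  move=> c x y; rewrite !(linearP (gtensor_elim _)) !scalerDr !scalerA (mulrC a) !addrA.
  by congr (_ + _); rewrite -!addrA; congr (_ + _); rewrite addrC.
rewrite -[RHS]/(mk_linear sl t); apply: gtensor_ext => Z f g e x y.
by rewrite mk_linearE !gtensor_elimE bl.
Qed.

(* Witnesses of f being an identity; there is at most one, and I_C in degree f
   is the direct sum of copies of k over these. *)
Inductive is_id : forall X Y : C, hom X Y -> Type :=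
| IsId X : is_id (idm X).

HB.instance Definition _ (X Y : C) (f : hom X Y) := gen_eqMixin (is_id f).
HB.instance Definition _ (X Y : C) (f : hom X Y) := gen_choiceMixin (is_id f).

Definition gunit : gmod :=
  GMod (fun X Y f => dsum (fun _ : is_id f => k^o)).

Definition gone X : gunit X X (idm X) := @dinj k _ (fun _ => k^o) (IsId X) 1.

End GradedModules.

Lemma is_id_unique (C : category) (X Y : C) (f : hom X Y) (w w' : is_id f) :
  w = w'.
Proof.
pose T (t : {X : C & {Y : C & hom X Y}}) := is_id (projT2 (projT2 t)).
pose s X Y f w := existT T (existT _ X (existT _ Y f)) w.
have sE Z Z' g (v : is_id g) : s Z Z' g v = s Z Z (idm Z) (IsId Z) by case: v.
have : s _ _ _ w = s _ _ _ w' by rewrite (sE _ _ _ w) (sE _ _ _ w').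
move=> e; have := projT2_eq e.
by rewrite (Prop_irrelevance (projT1_eq e) erefl).
Qed.

Section UnitActions.
Variables (k : comPzRingType) (C : category).
Local Notation gunit := (@gunit k C).

Lemma gunitP (X Y : C) (f : hom X Y) (c : gunit _ _ f) :
  c = 0 \/ exists w a, c = @dinj k _ (fun _ : is_id f => k^o) w a.
Proof.
have [[w _]|nw] := pselect (exists w : is_id f, True); last first.
  by left; apply: dsumP => w; case: nw; exists w.
right; exists w, (c w); apply: dsumP => w'.
by rewrite (is_id_unique w' w) /= dfwith_in.
Qed.

Definition gact (M N P : gmod k C) (mu : gmap (gtensor M N) P) (X Y Z : C)
    (f : hom X Y) (g : hom Y Z) (h : hom X Z) (e : g \oc f = h)
    (x : M _ _ f) (y : N _ _ g) : P _ _ h :=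
  mu _ _ h (gtens e x y).

Lemma gact_bilin (M N P : gmod k C) (mu : gmap (gtensor M N) P) (X Y Z : C)
    (f : hom X Y) (g : hom Y Z) (h : hom X Z) (e : g \oc f = h) :
  bilin (gact mu e).
Proof.
have [bl br] := @gtens_bilin _ _ M N _ _ _ f g h e.
split=> [y a x x'|x a y y']; rewrite /gact.
  by rewrite bl linearP.
by rewrite br linearP.
Qed.

Section BilinTheory.
Variables (U V W : lmodType k) (b : U -> V -> W) (bb : bilin b).

Lemma bilinZl a u v : b (a *: u) v = a *: b u v.
Proof. by have /= := linearZ_LR (mk_linear (bb.1 v)) a u. Qed.
Lemma bilinZr a u v : b u (a *: v) = a *: b u v.
Proof. by have /= := linearZ_LR (mk_linear (bb.2 u)) a v. Qed.
Lemma bilin0l v : b 0 v = 0.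
Proof. by have /= := linear0 (mk_linear (bb.1 v)). Qed.
Lemma bilin0r u : b u 0 = 0.
Proof. by have /= := linear0 (mk_linear (bb.2 u)). Qed.
End BilinTheory.

Definition gactZl M N P mu X Y Z f g h e :=
  bilinZl (@gact_bilin M N P mu X Y Z f g h e).
Definition gactZr M N P mu X Y Z f g h e :=
  bilinZr (@gact_bilin M N P mu X Y Z f g h e).
Definition gact0l M N P mu X Y Z f g h e :=
  bilin0l (@gact_bilin M N P mu X Y Z f g h e).
Definition gact0r M N P mu X Y Z f g h e :=
  bilin0r (@gact_bilin M N P mu X Y Z f g h e).

(* If f is an identity and g o f = h, then M_g = M_h; similarly on the right. *)
Definition drop_idl (M : gmod k C) (X Y Z : C) (f : hom X Y) (w : is_id f) :
    forall (g : hom Y Z) (h : hom X Z), g \oc f = h -> M _ _ g -> M _ _ h :=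
  match w in @is_id _ X Y f
    return forall (g : hom Y Z) (h : hom X Z), g \oc f = h ->
      M Y Z g -> M X Z h with
  | IsId X => fun g h e m =>
      eq_rect g (fun h => M X Z h) m h (etrans (esym (compm1 g)) e)
  end.

Definition drop_idr (M : gmod k C) (X Y Z : C) (g : hom Y Z) (w : is_id g) :
    forall (f : hom X Y) (h : hom X Z), g \oc f = h -> M _ _ f -> M _ _ h :=
  match w in @is_id _ Y Z g
    return forall (f : hom X Y) (h : hom X Z), g \oc f = h ->
      M X Y f -> M X Z h with
  | IsId Y => fun f h e m =>
      eq_rect f (fun h => M X Y h) m h (etrans (esym (comp1m f)) e)
  end.

Lemma drop_idl_linear M X Y Z f w g h e :
  linear (@drop_idl M X Y Z f w g h e).
Proof.
by destruct w => a x y /=; move: (etrans _ e) => {e} e; case: h / e.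
Qed.

Lemma drop_idr_linear M X Y Z g w f h e :
  linear (@drop_idr M X Y Z g w f h e).
Proof.
by destruct w => a x y /=; move: (etrans _ e) => {e} e; case: h / e.
Qed.

Section Unit.
Variables (M : gmod k C) (lam : forall X Y : C, hom X Y -> k).
Arguments lam {X Y}.

Definition unit_lmul (X Y Z : C) (f : hom X Y) (g : hom Y Z) (h : hom X Z)
    (e : g \oc f = h) (c : gunit _ _ f) (m : M _ _ g) : M _ _ h :=
  @dsum_elim _ _ (fun _ => k^o) _ (fun w =>
    mk_linear (scale_to_linear (lam g *: drop_idl w e m))) c.

Definition unit_rmul (X Y Z : C) (f : hom X Y) (g : hom Y Z) (h : hom X Z)
    (e : g \oc f = h) (m : M _ _ f) (c : gunit _ _ g) : M _ _ h :=
  @dsum_elim _ _ (fun _ => k^o) _ (fun w =>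
    mk_linear (scale_to_linear (lam f *: drop_idr w e m))) c.

Lemma dsum_elim_linear_l (I : choiceType) (U W : lmodType k)
    (phi : U -> I -> W) :
  (forall i, linear (phi^~ i)) ->
  forall c, linear (fun u => @dsum_elim _ I (fun _ => k^o) _ (fun i =>
    mk_linear (scale_to_linear (phi u i))) c).
Proof.
move=> lphi c a u v; rewrite !(@dsum_elim_seq _ _ _ _ _ _ (dsupp c));
  try exact: dsuppP.
rewrite scaler_sumr -big_split /=; apply: eq_bigr => i _.
by rewrite lphi scalerDr !scalerA mulrC.
Qed.

Lemma unit_lmul_bilin X Y Z f g h e : bilin (@unit_lmul X Y Z f g h e).
Proof.
split=> [m|c]; first exact: dsum_elim_linear.
apply: dsum_elim_linear_l => w a x y.
by rewrite drop_idl_linear scalerDr !scalerA mulrC.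
Qed.

Lemma unit_rmul_bilin X Y Z f g h e : bilin (@unit_rmul X Y Z f g h e).
Proof.
split=> [c|m]; last exact: dsum_elim_linear.
apply: dsum_elim_linear_l => w a x y.
by rewrite drop_idr_linear scalerDr !scalerA mulrC.
Qed.

(* c Id_X (x) m |-> (c * lam |m|) m *)
Definition unit_lact : gmap (gtensor gunit M) M := GMap (fun X Y h =>
  gtensor_elim (fun F : factorization h =>
    unit_lmul_bilin (factorizationE F))).

(* m (x) c Id_Y |-> (c * lam |m|) m *)
Definition unit_ract : gmap (gtensor M gunit) M := GMap (fun X Y h =>
  gtensor_elim (fun F : factorization h =>
    unit_rmul_bilin (factorizationE F))).

Lemma unit_lactE (X Y : C) (g : hom X Y) (e : g \oc idm X = g) (c : k) m :
  gact unit_lact e (@dinj k _ (fun _ => k^o) (IsId X) c) m = (c * lam g) *: m.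
Proof.
rewrite /gact /unit_lact gtensor_elimE /unit_lmul dsum_elim_inj mk_linearE /=.
by rewrite (Prop_irrelevance (etrans _ _) erefl) scalerA.
Qed.

Lemma unit_ractE (X Y : C) (f : hom X Y) (e : idm Y \oc f = f) (c : k) m :
  gact unit_ract e m (@dinj k _ (fun _ => k^o) (IsId Y) c) = (c * lam f) *: m.
Proof.
rewrite /gact /unit_ract gtensor_elimE /unit_rmul dsum_elim_inj mk_linearE /=.
by rewrite (Prop_irrelevance (etrans _ _) erefl) scalerA.
Qed.

End Unit.
End UnitActions.

Section Bimodules.
Variables (k : comPzRingType) (C : category) (al : grading k C).

Definition lunitor_coef (X Y : C) (g : hom X Y) : k :=
  uinv (al _ _ _ _ (idm X) (idm X) g).
Definition runitor_coef (X Y : C) (g : hom X Y) : k :=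
  uval (al _ _ _ _ g (idm Y) (idm Y)).

(* Below, gf, hg and l stand for g o f, h o g and h o g o f: see [gtens].
   A multiplication or an action is a graded map mu on a tensor product, and
   [gact mu e x y] is its value at x (x) y, in the degree fixed by e. *)
Record galgebra := GAlgebra {
  alg_mod :> gmod k C;
  mul : gmap (gtensor alg_mod alg_mod) alg_mod;
  one : forall X : C, alg_mod X X (idm X);
  mulA : forall (W X Y Z : C) (f : hom W X) (g : hom X Y) (h : hom Y Z)
      (gf : hom W Y) (hg : hom X Z) (l : hom W Z)
      (e1 : g \oc f = gf) (e2 : h \oc gf = l)
      (e3 : h \oc g = hg) (e4 : hg \oc f = l) x y z,
    gact mul e2 (gact mul e1 x y) z
    = uval (al _ _ _ _ f g h) *: gact mul e4 x (gact mul e3 y z);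
  mul1x : forall (X Y : C) (f : hom X Y) (e : f \oc idm X = f) x,
    gact mul e (one X) x = lunitor_coef f *: x;
  mulx1 : forall (X Y : C) (f : hom X Y) (e : idm Y \oc f = f) x,
    gact mul e x (one Y) = runitor_coef f *: x }.

Record bimodule (A B : galgebra) := Bimodule {
  bim_mod :> gmod k C;
  lact : gmap (gtensor A bim_mod) bim_mod;
  ract : gmap (gtensor bim_mod B) bim_mod;
  lactA : forall (W X Y Z : C) (f : hom W X) (g : hom X Y) (h : hom Y Z)
      (gf : hom W Y) (hg : hom X Z) (l : hom W Z)
      (e1 : g \oc f = gf) (e2 : h \oc gf = l)
      (e3 : h \oc g = hg) (e4 : hg \oc f = l) a a' m,
    gact lact e2 (gact (mul A) e1 a a') m
    = uval (al _ _ _ _ f g h) *: gact lact e4 a (gact lact e3 a' m);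
  ractA : forall (W X Y Z : C) (f : hom W X) (g : hom X Y) (h : hom Y Z)
      (gf : hom W Y) (hg : hom X Z) (l : hom W Z)
      (e1 : g \oc f = gf) (e2 : h \oc gf = l)
      (e3 : h \oc g = hg) (e4 : hg \oc f = l) m b b',
    gact ract e2 (gact ract e1 m b) b'
    = uval (al _ _ _ _ f g h) *: gact ract e4 m (gact (mul B) e3 b b');
  lractA : forall (W X Y Z : C) (f : hom W X) (g : hom X Y) (h : hom Y Z)
      (gf : hom W Y) (hg : hom X Z) (l : hom W Z)
      (e1 : g \oc f = gf) (e2 : h \oc gf = l)
      (e3 : h \oc g = hg) (e4 : hg \oc f = l) a m b,
    gact ract e2 (gact lact e1 a m) b
    = uval (al _ _ _ _ f g h) *: gact lact e4 a (gact ract e3 m b);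
  lact1 : forall (X Y : C) (f : hom X Y) (e : f \oc idm X = f) m,
    gact lact e (one A X) m = lunitor_coef f *: m;
  ract1 : forall (X Y : C) (f : hom X Y) (e : idm Y \oc f = f) m,
    gact ract e m (one B Y) = runitor_coef f *: m }.

Section Hom.
Variables (A B : galgebra) (M N : bimodule A B).

Definition commutes_lact (F : gmap M N) := forall (X Y Z : C)
  (f : hom X Y) (g : hom Y Z) (h : hom X Z) (e : g \oc f = h)
  (a : A _ _ f) (m : M _ _ g),
  F _ _ h (gact (lact M) e a m) = gact (lact N) e a (F _ _ g m).

Definition commutes_ract (F : gmap M N) := forall (X Y Z : C)
  (f : hom X Y) (g : hom Y Z) (h : hom X Z) (e : g \oc f = h)
  (m : M _ _ f) (b : B _ _ g),
  F _ _ h (gact (ract M) e m b) = gact (ract N) e (F _ _ f m) b.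

Record bimhom := Bimhom {
  bim_map :> gmap M N;
  bim_mapL : commutes_lact bim_map;
  bim_mapR : commutes_ract bim_map }.

HB.instance Definition _ := gen_eqMixin bimhom.
HB.instance Definition _ := gen_choiceMixin bimhom.

Lemma bimhomP (F G : bimhom) :
  (forall (X Y : C) (f : hom X Y), F X Y f =1 G X Y f) -> F = G.
Proof.
case: F G => [F FL FR] [G GL GR] /= /gmap_eq e.
by move: FL FR GL GR; rewrite e => *; congr Bimhom; exact: Prop_irrelevance.
Qed.

Definition bimhom0_map : gmap M N := GMap (fun X Y f => \0).
Definition bimhomD_map (F G : bimhom) : gmap M N :=
  GMap (fun X Y f => F X Y f \+ G X Y f).
Definition bimhomZ_map (c : k) (F : bimhom) : gmap M N :=
  GMap (fun X Y f => c \*: F X Y f).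

Lemma bimhom0L : commutes_lact bimhom0_map.
Proof. by move=> *; rewrite /bimhom0_map /= gact0r. Qed.
Lemma bimhom0R : commutes_ract bimhom0_map.
Proof. by move=> *; rewrite /bimhom0_map /= gact0l. Qed.
Definition bimhom0 := Bimhom bimhom0L bimhom0R.

Lemma bimhomD_L F G : commutes_lact (bimhomD_map F G).
Proof.
move=> X Y Z f g h e a m.
rewrite /bimhomD_map /= (bim_mapL F) (bim_mapL G).
have [_ br] := gact_bilin (lact N) e.
by rewrite -[F _ _ _ m]scale1r br !scale1r.
Qed.
Lemma bimhomD_R F G : commutes_ract (bimhomD_map F G).
Proof.
move=> X Y Z f g h e m b.
rewrite /bimhomD_map /= (bim_mapR F) (bim_mapR G).
have [bl _] := gact_bilin (ract N) e.
by rewrite -[F _ _ _ m]scale1r bl !scale1r.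
Qed.
Definition bimhomD F G := Bimhom (bimhomD_L F G) (bimhomD_R F G).

Lemma bimhomZ_L c F : commutes_lact (bimhomZ_map c F).
Proof. by move=> *; rewrite /bimhomZ_map /= (bim_mapL F) gactZr. Qed.
Lemma bimhomZ_R c F : commutes_ract (bimhomZ_map c F).
Proof. by move=> *; rewrite /bimhomZ_map /= (bim_mapR F) gactZl. Qed.
Definition bimhomZ c F := Bimhom (bimhomZ_L c F) (bimhomZ_R c F).

Definition bimhomN F := bimhomZ (-1) F.

Lemma bimhomDA : associative bimhomD.
Proof. by move=> F G H; apply: bimhomP => X Y f x /=; rewrite addrA. Qed.
Lemma bimhomDC : commutative bimhomD.
Proof. by move=> F G; apply: bimhomP => X Y f x /=; rewrite addrC. Qed.
Lemma bimhom0D : left_id bimhom0 bimhomD.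
Proof. by move=> F; apply: bimhomP => X Y f x /=; rewrite add0r. Qed.
Lemma bimhomND : left_inverse bimhom0 bimhomN bimhomD.
Proof. by move=> F; apply: bimhomP => X Y f x /=; rewrite scaleN1r addNr. Qed.

HB.instance Definition _ :=
  GRing.isZmodule.Build bimhom bimhomDA bimhomDC bimhom0D bimhomND.

Lemma bimhomZA a b F : bimhomZ a (bimhomZ b F) = bimhomZ (a * b) F.
Proof. by apply: bimhomP => X Y f x /=; rewrite scalerA. Qed.
Lemma bimhomZ1 : left_id 1 bimhomZ.
Proof. by move=> F; apply: bimhomP => X Y f x /=; rewrite scale1r. Qed.
Lemma bimhomZDr : right_distributive bimhomZ +%R.
Proof. by move=> a F G; apply: bimhomP => X Y f x /=; rewrite scalerDr. Qed.
Lemma bimhomZDl F : {morph bimhomZ^~ F : a b / a + b}.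
Proof. by move=> a b; apply: bimhomP => X Y f x /=; rewrite scalerDl. Qed.

HB.instance Definition _ :=
  GRing.Zmodule_isLmodule.Build k bimhom bimhomZA bimhomZ1 bimhomZDr bimhomZDl.

End Hom.

Lemma alV (W X Y Z : C) (f : hom W X) (g : hom X Y) (h : hom Y Z) :
  uval (al _ _ _ _ f g h) * uinv (al _ _ _ _ f g h) = 1.
Proof. exact: uvalV. Qed.

Lemma al_1f1 (X Y : C) (f : hom X Y) :
  uval (al _ _ _ _ (idm X) f (idm Y)) = 1.
Proof.
have := assoc_cocycle al (idm X) (idm X) f (idm Y).
by rewrite !compm1 !comp1m uvalV mul1r uvalV mul1r.
Qed.

Lemma lunitor_coef1 (X : C) : lunitor_coef (idm X) = 1.
Proof.
by have := alV (idm X) (idm X) (idm X); rewrite al_1f1 mul1r.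
Qed.

Lemma runitor_coef1 (X : C) : runitor_coef (idm X) = 1.
Proof. exact: al_1f1. Qed.

Definition unit_mul : gmap (gtensor (gunit k C) (gunit k C)) (gunit k C) :=
  unit_lact (gunit k C) (fun _ _ _ => 1).

Section UnitAlgebra.
Local Notation I := (gunit k C).

Lemma unit_mulA (W X Y Z : C) (f : hom W X) (g : hom X Y) (h : hom Y Z)
    (gf : hom W Y) (hg : hom X Z) (l : hom W Z)
    (e1 : g \oc f = gf) (e2 : h \oc gf = l)
    (e3 : h \oc g = hg) (e4 : hg \oc f = l)
    (x : I _ _ f) (y : I _ _ g) (z : I _ _ h) :
  gact unit_mul e2 (gact unit_mul e1 x y) z
  = uval (al _ _ _ _ f g h) *: gact unit_mul e4 x (gact unit_mul e3 y z).
Proof.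
have [->|[w [a ->]]] := gunitP x; first by rewrite !gact0l scaler0.
have [->|[w' [b ->]]] := gunitP y; first by rewrite !(gact0l, gact0r) scaler0.
have [->|[w'' [c ->]]] := gunitP z; first by rewrite !gact0r scaler0.
destruct w, w'; have E := etrans (esym (comp1m _)) e1; destruct E.
have E := etrans (esym (compm1 _)) e3; destruct E.
have E := etrans (esym (compm1 _)) e2; destruct E.
destruct w''; rewrite /unit_mul !(unit_lactE, gactZl, gactZr) !scalerA al_1f1.
by congr (_ *: _); ring.
Qed.

Lemma unit_mul1x (X Y : C) (f : hom X Y) (e : f \oc idm X = f) (x : I _ _ f) :
  gact unit_mul e (gone k X) x = lunitor_coef f *: x.
Proof.
have [->|[w [a ->]]] := gunitP x; first by rewrite gact0r scaler0.
by destruct w; rewrite /unit_mul unit_lactE lunitor_coef1 mulr1.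
Qed.

Lemma unit_mulx1 (X Y : C) (f : hom X Y) (e : idm Y \oc f = f) (x : I _ _ f) :
  gact unit_mul e x (gone k Y) = runitor_coef f *: x.
Proof.
have [->|[w [a ->]]] := gunitP x; first by rewrite gact0l scaler0.
destruct w; rewrite /unit_mul unit_lactE runitor_coef1 mulr1 scale1r.
by rewrite -(linearZ_LR (@dinj k _ (fun=> k^o) (IsId X))) [_ *: _]mulr1.
Qed.

(* I_C with the multiplication of scalars; the axioms hold because the cocycle
   condition forces al(Id, f, Id) = 1. *)
Definition unit_algebra : galgebra := GAlgebra unit_mulA unit_mul1x unit_mulx1.

Section UnitBimodule.
Variable M : gmod k C.

Definition unitor_lact : gmap (gtensor I M) M := unit_lact M lunitor_coef.
Definition unitor_ract : gmap (gtensor M I) M := unit_ract M runitor_coef.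

Lemma unitor_lactA (W X Y Z : C) (f : hom W X) (g : hom X Y) (h : hom Y Z)
    (gf : hom W Y) (hg : hom X Z) (l : hom W Z)
    (e1 : g \oc f = gf) (e2 : h \oc gf = l)
    (e3 : h \oc g = hg) (e4 : hg \oc f = l)
    (a : I _ _ f) (a' : I _ _ g) (m : M _ _ h) :
  gact unitor_lact e2 (gact unit_mul e1 a a') m
  = uval (al _ _ _ _ f g h) *: gact unitor_lact e4 a (gact unitor_lact e3 a' m).
Proof.
have [->|[w [c ->]]] := gunitP a; first by rewrite !gact0l scaler0.
have [->|[w' [d ->]]] := gunitP a'; first by rewrite !(gact0l, gact0r) scaler0.
destruct w, w'; have E := etrans (esym (comp1m _)) e1; destruct E.
have E := etrans (esym (compm1 _)) e3; destruct E.
have E := etrans (esym (compm1 _)) e2; destruct E.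
rewrite /unitor_lact /unit_mul !(unit_lactE, gactZl, gactZr) !scalerA.
congr (_ *: _); rewrite /lunitor_coef.
set u := al _ _ _ _ _ _ _; by rewrite -[LHS]mul1r -{1}(uvalV u); ring.
Qed.

Lemma unitor_ractA (W X Y Z : C) (f : hom W X) (g : hom X Y) (h : hom Y Z)
    (gf : hom W Y) (hg : hom X Z) (l : hom W Z)
    (e1 : g \oc f = gf) (e2 : h \oc gf = l)
    (e3 : h \oc g = hg) (e4 : hg \oc f = l)
    (m : M _ _ f) (b : I _ _ g) (b' : I _ _ h) :
  gact unitor_ract e2 (gact unitor_ract e1 m b) b'
  = uval (al _ _ _ _ f g h) *: gact unitor_ract e4 m (gact unit_mul e3 b b').
Proof.
have [->|[w [c ->]]] := gunitP b; first by rewrite !(gact0l, gact0r) scaler0.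
have [->|[w' [d ->]]] := gunitP b'; first by rewrite !(gact0l, gact0r) scaler0.
destruct w, w'; have E := etrans (esym (comp1m _)) e1; destruct E.
have E := etrans (esym (compm1 _)) e3; destruct E.
have E := etrans (esym (comp1m _)) e2; destruct E.
rewrite /unitor_ract /unit_mul !(unit_lactE, unit_ractE, gactZl, gactZr).
rewrite !scalerA; congr (_ *: _); rewrite /runitor_coef; ring.
Qed.

Lemma unitor_lractA (W X Y Z : C) (f : hom W X) (g : hom X Y) (h : hom Y Z)
    (gf : hom W Y) (hg : hom X Z) (l : hom W Z)
    (e1 : g \oc f = gf) (e2 : h \oc gf = l)
    (e3 : h \oc g = hg) (e4 : hg \oc f = l)
    (a : I _ _ f) (m : M _ _ g) (b : I _ _ h) :
  gact unitor_ract e2 (gact unitor_lact e1 a m) b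
  = uval (al _ _ _ _ f g h) *: gact unitor_lact e4 a (gact unitor_ract e3 m b).
Proof.
have [->|[w [c ->]]] := gunitP a; first by rewrite !(gact0l, gact0r) scaler0.
have [->|[w' [d ->]]] := gunitP b; first by rewrite !(gact0l, gact0r) scaler0.
destruct w, w'; have E := etrans (esym (compm1 _)) e1; destruct E.
have E := etrans (esym (comp1m _)) e3; destruct E.
have E := etrans (esym (comp1m _)) e2; destruct E.
rewrite /unitor_ract /unitor_lact !(unit_lactE, unit_ractE, gactZl, gactZr).
by rewrite !scalerA al_1f1; congr (_ *: _); ring.
Qed.

Lemma unitor_lact1 (X Y : C) (f : hom X Y) (e : f \oc idm X = f) m :
  gact unitor_lact e (one unit_algebra X) m = lunitor_coef f *: m.
Proof. by rewrite /unitor_lact unit_lactE mul1r. Qed.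

Lemma unitor_ract1 (X Y : C) (f : hom X Y) (e : idm Y \oc f = f) m :
  gact unitor_ract e m (one unit_algebra Y) = runitor_coef f *: m.
Proof. by rewrite /unitor_ract unit_ractE mul1r. Qed.

(* A graded module, seen as an (I_C, I_C)-bimodule through the unitors. *)
Definition unit_bimodule : bimodule unit_algebra unit_algebra :=
  @Bimodule unit_algebra unit_algebra M unitor_lact unitor_ract
    unitor_lactA unitor_ractA unitor_lractA unitor_lact1 unitor_ract1.

End UnitBimodule.
End UnitAlgebra.

Section TensorPowers.
Variable A : galgebra.

Lemma comp_lact (X Y Z : C) (f : hom X Y) (g : hom Y Z) (h : hom X Z)
    (e : g \oc f = h) (F : factorization g) :
  fsnd F \oc (ffst F \oc f) = h.
Proof. by rewrite compmA factorizationE. Qed.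

Lemma comp_ract (X Y Z : C) (f : hom X Y) (g : hom Y Z) (h : hom X Z)
    (e : g \oc f = h) (F : factorization f) :
  (g \oc fsnd F) \oc ffst F = h.
Proof. by rewrite -compmA factorizationE. Qed.

Section Actions.
Variable N : gmod k C.

Section Left.
Variable rho : gmap (gtensor A N) N.

Definition tens_lmul_pure (X Y Z : C) (f : hom X Y) (g : hom Y Z) (h : hom X Z)
    (e : g \oc f = h) (a : A _ _ f) (F : factorization g)
    (t : N _ _ (ffst F)) (x : A _ _ (fsnd F)) : gtensor N A X Z h :=
  uinv (al _ _ _ _ f (ffst F) (fsnd F))
    *: gtens (comp_lact e F) (gact rho erefl a t) x.

Lemma tens_lmul_pure_bilin X Y Z f g h e a F :
  bilin (@tens_lmul_pure X Y Z f g h e a F).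
Proof.
have [gl gr] := gtens_bilin N A (comp_lact e F).
have [_ rr] := gact_bilin rho (erefl (ffst F \oc f)).
split=> [x c t t'|t c x x'] /=; rewrite /tens_lmul_pure.
  by rewrite rr gl scalerDr !scalerA mulrC.
by rewrite gr scalerDr !scalerA mulrC.
Qed.

Definition tens_lmul (X Y Z : C) (f : hom X Y) (g : hom Y Z) (h : hom X Z)
    (e : g \oc f = h) (a : A _ _ f) :
    gtensor N A Y Z g -> gtensor N A X Z h :=
  gtensor_elim (tens_lmul_pure_bilin e a).

Lemma tens_lmul_bilin X Y Z f g h e : bilin (@tens_lmul X Y Z f g h e).
Proof.
split=> [t|a]; last exact: linearP.
apply: gtensor_elim_linear => F n x c a a'.
have [gl _] := gtens_bilin N A (comp_lact e F).
have [rl _] := gact_bilin rho (erefl (ffst F \oc f)).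
by rewrite /tens_lmul_pure rl gl scalerDr !scalerA mulrC.
Qed.

(* a (x) (t (x) x) |-> al(|a|, |t|, |x|)^-1 rho(a, t) (x) x *)
Definition tens_lact : gmap (gtensor A (gtensor N A)) (gtensor N A) :=
  GMap (fun X Y h => gtensor_elim (fun F : factorization h =>
    tens_lmul_bilin (factorizationE F))).

Lemma tens_lactE (W X Y Z : C) (f : hom W X) (g : hom X Y) (h : hom Y Z)
    (gf : hom W Y) (hg : hom X Z) (l : hom W Z)
    (e1 : g \oc f = gf) (e2 : h \oc gf = l)
    (e3 : h \oc g = hg) (e4 : hg \oc f = l) a t x :
  gact tens_lact e4 a (gtens e3 t x)
  = uinv (al _ _ _ _ f g h) *: gtens e2 (gact rho e1 a t) x.
Proof.
rewrite /gact /tens_lact gtensor_elimE /tens_lmul gtensor_elimE.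
rewrite /tens_lmul_pure /=; destruct e1; congr (_ *: gtens _ _ _).
exact: Prop_irrelevance.
Qed.

End Left.

Definition tens_rmul_pure (X Y Z : C) (f : hom X Y) (g : hom Y Z) (h : hom X Z)
    (e : g \oc f = h) (a : A _ _ g) (F : factorization f)
    (t : N _ _ (ffst F)) (x : A _ _ (fsnd F)) : gtensor N A X Z h :=
  uval (al _ _ _ _ (ffst F) (fsnd F) g)
    *: gtens (comp_ract e F) t (gact (mul A) erefl x a).

Lemma tens_rmul_pure_bilin X Y Z f g h e a F :
  bilin (@tens_rmul_pure X Y Z f g h e a F).
Proof.
have [gl gr] := gtens_bilin N A (comp_ract e F).
have [rl _] := gact_bilin (mul A) (erefl (g \oc fsnd F)).
split=> [x c t t'|t c x x'] /=; rewrite /tens_rmul_pure.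
  by rewrite gl scalerDr !scalerA mulrC.
by rewrite rl gr scalerDr !scalerA mulrC.
Qed.

Definition tens_rmul (X Y Z : C) (f : hom X Y) (g : hom Y Z) (h : hom X Z)
    (e : g \oc f = h) (t : gtensor N A X Y f) (a : A _ _ g) :
    gtensor N A X Z h :=
  gtensor_elim (tens_rmul_pure_bilin e a) t.

Lemma tens_rmul_bilin X Y Z f g h e : bilin (@tens_rmul X Y Z f g h e).
Proof.
split=> [a|t]; first exact: linearP.
apply: gtensor_elim_linear => F n x c a a'.
have [_ gr] := gtens_bilin N A (comp_ract e F).
have [_ rr] := gact_bilin (mul A) (erefl (g \oc fsnd F)).
by rewrite /tens_rmul_pure rr gr scalerDr !scalerA mulrC.
Qed.

(* (t (x) x) (x) a |-> al(|t|, |x|, |a|) t (x) mul(x, a) *)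
Definition tens_ract : gmap (gtensor (gtensor N A) A) (gtensor N A) :=
  GMap (fun X Y h => gtensor_elim (fun F : factorization h =>
    tens_rmul_bilin (factorizationE F))).

Lemma tens_ractE (W X Y Z : C) (f : hom W X) (g : hom X Y) (h : hom Y Z)
    (gf : hom W Y) (hg : hom X Z) (l : hom W Z)
    (e1 : g \oc f = gf) (e2 : h \oc gf = l)
    (e3 : h \oc g = hg) (e4 : hg \oc f = l) t x a :
  gact tens_ract e2 (gtens e1 t x) a
  = uval (al _ _ _ _ f g h) *: gtens e4 t (gact (mul A) e3 x a).
Proof.
rewrite /gact /tens_ract gtensor_elimE /tens_rmul gtensor_elimE.
rewrite /tens_rmul_pure /=; destruct e3; congr (_ *: gtens _ _ _).
exact: Prop_irrelevance.
Qed.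

End Actions.

Fixpoint tpow (n : nat) : gmod k C :=
  match n with
  | 0 => gunit k C
  | n'.+1 => match n' with 0 => A | _.+1 => gtensor (tpow n') A end
  end.

(* On A^{(x) n.+1}, unfolding this recursion multiplies mul(a, a_0) (x) a_1 (x) ..
   by the product of the al(|a|, |a_(i-1)| o .. o |a_0|, |a_i|)^-1, 1 <= i <= n. *)
Fixpoint tpow_lact (n : nat) : gmap (gtensor A (tpow n.+1)) (tpow n.+1) :=
  match n with
  | 0 => mul A
  | n'.+1 => tens_lact (tpow_lact n')
  end.

Definition tpow_ract (n : nat) : gmap (gtensor (tpow n.+2) A) (tpow n.+2) :=
  tens_ract (tpow n.+1).

Lemma cocycle_coefs (a1 a2 a3 a4 a5 : units k) :
  uval a1 * uinv a2 * uval a3 * uinv a4 * uval a5 = 1 ->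
  [/\ uinv a4 * uval a1 = uval a2 * uinv a5 * uinv a3,
      uval a1 * uval a3 * uval a5 = uval a4 * uval a2 &
      uinv a1 * uval a4 = uval a3 * (uval a5 * uinv a2)].
Proof.
case: a1 a2 a3 a4 a5 => [x1 y1 /= v1] [x2 y2 /= v2] [x3 y3 /= v3] [x4 y4 /= v4].
case=> [x5 y5 /= v5] E; split.
- transitivity ((x2 * y2) * (x3 * y3) * (x5 * y5) * (y4 * x1)).
    by rewrite v2 v3 v5; ring.
  transitivity (x2 * y5 * y3 * (x1 * y2 * x3 * y4 * x5)); first by ring.
  by rewrite E mulr1.
- transitivity ((x4 * y4) * (x2 * y2) * (x1 * x3 * x5)).
    by rewrite v2 v4; ring.
  transitivity (x4 * x2 * (x1 * y2 * x3 * y4 * x5)); first by ring.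
  by rewrite E mulr1.
- transitivity (y1 * x4 * (x1 * y2 * x3 * y4 * x5)); first by rewrite E mulr1.
  transitivity ((x1 * y1) * (x4 * y4) * (x3 * (x5 * y2))); first by ring.
  by rewrite v1 v4 !mul1r.
Qed.

Definition glinl (M N P : gmod k C) (mu : gmap (gtensor M N) P) (X Y Z : C)
    (f : hom X Y) (g : hom Y Z) (h : hom X Z) (e : g \oc f = h) (y : N _ _ g) :
  {linear M _ _ f -> P _ _ h} := mk_linear ((gact_bilin mu e).1 y).

Definition glinr (M N P : gmod k C) (mu : gmap (gtensor M N) P) (X Y Z : C)
    (f : hom X Y) (g : hom Y Z) (h : hom X Z) (e : g \oc f = h) (x : M _ _ f) :
  {linear N _ _ g -> P _ _ h} := mk_linear ((gact_bilin mu e).2 x).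

Section TensorAxioms.
Variables (N : gmod k C) (rho : gmap (gtensor A N) N).

Local Notation L := (tens_lact rho).
Local Notation R := (@tens_ract N).

Definition is_lactA := forall (W X Y Z : C) (f : hom W X) (g : hom X Y) (h : hom Y Z)
    (gf : hom W Y) (hg : hom X Z) (l : hom W Z)
    (e1 : g \oc f = gf) (e2 : h \oc gf = l)
    (e3 : h \oc g = hg) (e4 : hg \oc f = l) a a' m,
  gact rho e2 (gact (mul A) e1 a a') m
  = uval (al _ _ _ _ f g h) *: gact rho e4 a (gact rho e3 a' m).

Definition is_lact1 := forall (X Y : C) (f : hom X Y) (e : f \oc idm X = f) m,
  gact rho e (one A X) m = lunitor_coef f *: m.

Lemma gtensZl (M : gmod k C) (X Y Z : C) (f : hom X Y) (g : hom Y Z)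
    (h : hom X Z) (e : g \oc f = h) c (x : N _ _ f) (y : M _ _ g) :
  gtens e (c *: x) y = c *: gtens e x y.
Proof. exact: (bilinZl (gtens_bilin N M e)). Qed.

Lemma gtensZr (M : gmod k C) (X Y Z : C) (f : hom X Y) (g : hom Y Z)
    (h : hom X Z) (e : g \oc f = h) c (x : N _ _ f) (y : M _ _ g) :
  gtens e x (c *: y) = c *: gtens e x y.
Proof. exact: (bilinZr (gtens_bilin N M e)). Qed.

Lemma tens_lactA : is_lactA -> forall (W X Y Z : C) (f : hom W X) (g : hom X Y) (h : hom Y Z)
    (gf : hom W Y) (hg : hom X Z) (l : hom W Z)
    (e1 : g \oc f = gf) (e2 : h \oc gf = l)
    (e3 : h \oc g = hg) (e4 : hg \oc f = l) a a' m,
  gact L e2 (gact (mul A) e1 a a') m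
  = uval (al _ _ _ _ f g h) *: gact L e4 a (gact L e3 a' m).
Proof.
move=> rA W X Y Z f g h gf hg l e1 e2 e3 e4 a a'.
apply: (@gtensor_ext _ _ _ _ _ _ _ _ (glinr L e2 _)
  (uval (al _ _ _ _ f g h) \*: (glinr L e4 a \o glinr L e3 a'))).
move=> V p q e n x /=.
have E1 : q \oc (p \oc gf) = l by rewrite compmA e.
have E2 : (p \oc g) \oc f = p \oc gf by rewrite -compmA e1.
have E3 : q \oc (p \oc g) = hg by rewrite compmA e.
rewrite (tens_lactE rho erefl E1 e e2) (rA _ _ _ _ _ _ _ _ _ _ e1 erefl erefl E2).
rewrite (tens_lactE rho erefl E3 e e3) gactZr (tens_lactE rho E2 E1 E3 e4).
rewrite gtensZl !scalerA; congr (_ *: _).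
destruct e, e1.
by have [-> _ _] := cocycle_coefs (assoc_cocycle al f g p q); ring.
Qed.

Lemma tens_ractA (W X Y Z : C) (f : hom W X) (g : hom X Y) (h : hom Y Z)
    (gf : hom W Y) (hg : hom X Z) (l : hom W Z)
    (e1 : g \oc f = gf) (e2 : h \oc gf = l)
    (e3 : h \oc g = hg) (e4 : hg \oc f = l) m b b' :
  gact R e2 (gact R e1 m b) b'
  = uval (al _ _ _ _ f g h) *: gact R e4 m (gact (mul A) e3 b b').
Proof.
move: m; apply: (@gtensor_ext _ _ _ _ _ _ _ _ (glinl R e2 _ \o glinl R e1 _)
  (uval (al _ _ _ _ f g h) \*: glinl R e4 _)).
move=> V p q e n x /=.
have E1 : (g \oc q) \oc p = gf by rewrite -compmA e.
have E2 : (h \oc (g \oc q)) \oc p = l by rewrite -compmA E1.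
have E3 : hg \oc q = h \oc (g \oc q) by rewrite compmA e3.
rewrite (tens_ractE e e1 erefl E1) gactZl (tens_ractE E1 e2 erefl E2).
rewrite (tens_ractE e e4 E3 E2) (mulA erefl erefl e3 E3).
rewrite gtensZr !scalerA; congr (_ *: _).
destruct e, e3.
have [_ E _] := cocycle_coefs (assoc_cocycle al p q g h).
by rewrite E mulrC.
Qed.

Lemma tens_lractA (W X Y Z : C) (f : hom W X) (g : hom X Y) (h : hom Y Z)
    (gf : hom W Y) (hg : hom X Z) (l : hom W Z)
    (e1 : g \oc f = gf) (e2 : h \oc gf = l)
    (e3 : h \oc g = hg) (e4 : hg \oc f = l) a m b :
  gact R e2 (gact L e1 a m) b
  = uval (al _ _ _ _ f g h) *: gact L e4 a (gact R e3 m b).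
Proof.
move: m; apply: (@gtensor_ext _ _ _ _ _ _ _ _ (glinl R e2 _ \o glinr L e1 _)
  (uval (al _ _ _ _ f g h) \*: (glinr L e4 _ \o glinl R e3 _))).
move=> V p q e n x /=.
have E1 : q \oc (p \oc f) = gf by rewrite compmA e.
have E2 : (h \oc q) \oc (p \oc f) = l by rewrite -compmA E1.
have E3 : (h \oc q) \oc p = hg by rewrite -compmA e.
rewrite (tens_lactE rho erefl E1 e e1) gactZl (tens_ractE E1 e2 erefl E2).
rewrite (tens_ractE e e3 erefl E3) gactZr (tens_lactE rho erefl E2 E3 e4).
rewrite !scalerA; congr (_ *: _).
destruct e.
have [_ _ ->] := cocycle_coefs (assoc_cocycle al f p q h); exact: mulrA.
Qed.

Lemma tens_lact1 : is_lact1 ->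
  forall (X Y : C) (f : hom X Y) (e : f \oc idm X = f) m,
  gact L e (one A X) m = lunitor_coef f *: m.
Proof.
move=> r1 X Y f e.
apply: (@gtensor_ext _ _ _ _ _ _ _ _ (glinr L e _)
  (lunitor_coef f \*: idfun)).
move=> V p q e' n x /=.
rewrite (tens_lactE rho (compm1 p) e' e' e) r1 gtensZl scalerA.
congr (_ *: _); rewrite /lunitor_coef; destruct e'.
have := assoc_cocycle al (idm X) (idm X) p q.
rewrite !compm1 => /cocycle_coefs[_ _].
set u := al _ _ _ _ _ p q => E.
have V' := uvalV u.
set y := uinv (al _ _ _ _ _ _ p) in E *.
set z := uinv (al _ _ _ _ _ _ (q \oc p)) in E *.
transitivity (uinv u * uinv u * (y * uval u)).
  transitivity ((uval u * uinv u) * (uinv u * y)); last by ring.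
  by rewrite V' mul1r.
rewrite E; transitivity ((uval u * uinv u) * (uval u * uinv u) * z); first by ring.
by rewrite V' !mul1r.
Qed.

Lemma tens_ract1 (X Y : C) (f : hom X Y) (e : idm Y \oc f = f) m :
  gact R e m (one A Y) = runitor_coef f *: m.
Proof.
move: m; apply: (@gtensor_ext _ _ _ _ _ _ _ _ (glinl R e _)
  (runitor_coef f \*: idfun)).
move=> V p q e' n x /=.
rewrite (tens_ractE e' e (comp1m q) e') mulx1 gtensZr scalerA.
congr (_ *: _); rewrite /runitor_coef; destruct e'.
have := assoc_cocycle al p q (idm Y) (idm Y).
rewrite !comp1m => /cocycle_coefs[_ E _].
set u := al _ _ _ _ p q _ in E *.
transitivity (uinv u * (uval u * uval u * uval (al _ _ _ _ q (idm Y) (idm Y)))).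
  by rewrite -[LHS]mul1r -{1}(uvalV u); ring.
by rewrite E mulrCA [_ * uval u]mulrC uvalV mulr1.
Qed.

End TensorAxioms.

Lemma tpow_lactA n : is_lactA (tpow_lact n).
Proof.
elim: n => [|n IH]; first by move=> *; exact: mulA.
exact: tens_lactA.
Qed.

Lemma tpow_lact1 n : is_lact1 (tpow_lact n).
Proof.
elim: n => [|n IH]; first by move=> *; exact: mul1x.
exact: tens_lact1.
Qed.

Definition tpow_bimodule (n : nat) : bimodule A A :=
  @Bimodule A A (tpow n.+2) (tpow_lact n.+1) (tpow_ract n)
    (@tpow_lactA n.+1) (@tens_ractA (tpow n.+1))
    (@tens_lractA _ (tpow_lact n)) (@tpow_lact1 n.+1)
    (@tens_ract1 (tpow n.+1)).

End TensorPowers.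

End Bimodules.

(* Main.v *)
(** [A^{n+1}] is the free left [A]-module on [A^n]: rebracketing identifies it
    with [A (x) A^n], so a graded map [g : A^n -> M] extends uniquely to the
    left-linear map sending [a (x) t] to [a . g t].  Likewise, for a left
    module [N], a left-linear map [G : N -> M] extends uniquely to the bimodule
    map [N (x) A -> M] sending [t (x) x] to [G t . x].  The inverses restrict
    to the units, up to the invertible unitor constants; all the coefficients
    match by the cocycle condition. *)
From mathcomp Require Import all_boot all_algebra.
From mathcomp Require Import boolp ring.
Require Import Defs.

Set Implicit Arguments.
Unset Strict Implicit.
Unset Printing Implicit Defensive.

Import GRing.Theory.
Local Open Scope ring_scope.

Section FreeBimodules.
Variables (k : comPzRingType) (C : category) (al : grading k C).

(** * Coefficient identities at identity morphisms *)

Lemma alVl (W X Y Z : C) (f : hom W X) (g : hom X Y) (h : hom Y Z) :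
  uinv (al _ _ _ _ f g h) * uval (al _ _ _ _ f g h) = 1.
Proof. by rewrite mulrC alV. Qed.

Lemma uval_mulI (u : units k) : injective (fun c => uval u * c).
Proof.
move=> c d /(congr1 (fun z => uinv u * z)) /=.
by rewrite !mulrA [uinv u * _]mulrC uvalV !mul1r.
Qed.

(** The cocycle condition at (f, Id, Id, g): three of its five coefficients are al(f, Id, g), two of
    them with opposite exponents. *)
Lemma al_triangle (X Y Z : C) (f : hom X Y) (g : hom Y Z) :
  uval (al _ _ _ _ f (idm Y) g)
  = runitor_coef al f * uval (al _ _ _ _ (idm Y) (idm Y) g).
Proof.
have := assoc_cocycle al f (idm Y) (idm Y) g.
rewrite !comp1m !compm1 => /cocycle_coefs[_ E _].
by apply: (@uval_mulI (al _ _ _ _ f (idm Y) g)); rewrite /= -E /runitor_coef; ring.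
Qed.

(** The cocycle condition at (f, g, Id, Id), whose first three coefficients all equal al(f, g,
    Id). *)
Lemma runitor_coef_comp (X Y Z : C) (f : hom X Y) (g : hom Y Z) :
  runitor_coef al (g \oc f) = uval (al _ _ _ _ f g (idm Z)) * runitor_coef al g.
Proof.
have := assoc_cocycle al f g (idm Z) (idm Z).
rewrite !comp1m => /cocycle_coefs[_ E _].
apply: (@uval_mulI (al _ _ _ _ f g (idm Z))).
by rewrite /= mulrA E mulrC.
Qed.

(** * Rebracketing triple tensor products *)

Section Rebracket.
Variables (K T P B : gmod k C).

Section Left.
Variable th : gmap (gtensor K T) P.

Definition rebracket_pure (X Y Z : C) (f : hom X Y) (g : hom Y Z) (h : hom X Z)
    (e : g \oc f = h) (a : K _ _ f) (F : factorization g)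
    (t : T _ _ (ffst F)) (x : B _ _ (fsnd F)) : gtensor P B X Z h :=
  uinv (al _ _ _ _ f (ffst F) (fsnd F))
    *: gtens (comp_lact e F) (gact th erefl a t) x.

Lemma rebracket_pure_bilin X Y Z f g h e a F :
  bilin (@rebracket_pure X Y Z f g h e a F).
Proof.
have [gl gr] := gtens_bilin P B (comp_lact e F).
have [_ rr] := gact_bilin th (erefl (ffst F \oc f)).
split=> [x c t t'|t c x x'] /=; rewrite /rebracket_pure.
  by rewrite rr gl scalerDr !scalerA mulrC.
by rewrite gr scalerDr !scalerA mulrC.
Qed.

Definition rebracket_elim (X Y Z : C) (f : hom X Y) (g : hom Y Z) (h : hom X Z)
    (e : g \oc f = h) (a : K _ _ f) :
    gtensor T B Y Z g -> gtensor P B X Z h :=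
  gtensor_elim (rebracket_pure_bilin e a).

Lemma rebracket_bilin X Y Z f g h e : bilin (@rebracket_elim X Y Z f g h e).
Proof.
split=> [t|a]; last exact: linearP.
apply: gtensor_elim_linear => F n x c a a'.
have [gl _] := gtens_bilin P B (comp_lact e F).
have [rl _] := gact_bilin th (erefl (ffst F \oc f)).
by rewrite /rebracket_pure rl gl scalerDr !scalerA mulrC.
Qed.

(** The inverse associator K (x) (T (x) B) -> (K (x) T) (x) B followed by [th] (x) id. The action
    [tens_lact rho] is the instance K = B = A, T = P = N. *)
Definition rebracket : gmap (gtensor K (gtensor T B)) (gtensor P B) :=
  GMap (fun X Y h => gtensor_elim (fun F : factorization h =>
    rebracket_bilin (factorizationE F))).

Lemma rebracketE (W X Y Z : C) (f : hom W X) (g : hom X Y) (h : hom Y Z)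
    (gf : hom W Y) (hg : hom X Z) (l : hom W Z)
    (e1 : g \oc f = gf) (e2 : h \oc gf = l)
    (e3 : h \oc g = hg) (e4 : hg \oc f = l) a t x :
  gact rebracket e4 a (gtens e3 t x)
  = uinv (al _ _ _ _ f g h) *: gtens e2 (gact th e1 a t) x.
Proof.
rewrite /gact /rebracket gtensor_elimE /rebracket_elim gtensor_elimE.
rewrite /rebracket_pure /=; destruct e1; congr (_ *: gtens _ _ _).
exact: Prop_irrelevance.
Qed.

End Left.

Section Right.
Variable th' : gmap P (gtensor K T).

Definition unbracket_pure (X Y Z : C) (f : hom X Y) (g : hom Y Z) (h : hom X Z)
    (e : g \oc f = h) (x : B _ _ g) (F : factorization f)
    (a : K _ _ (ffst F)) (t : T _ _ (fsnd F)) :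
    gtensor K (gtensor T B) X Z h :=
  uval (al _ _ _ _ (ffst F) (fsnd F) g)
    *: gtens (comp_ract e F) a (gtens erefl t x).

Lemma unbracket_pure_bilin X Y Z f g h e x F :
  bilin (@unbracket_pure X Y Z f g h e x F).
Proof.
have [gl gr] := gtens_bilin K (gtensor T B) (comp_ract e F).
have [rl _] := gtens_bilin T B (erefl (g \oc fsnd F)).
split=> [t c a a'|a c t t'] /=; rewrite /unbracket_pure.
  by rewrite gl scalerDr !scalerA mulrC.
by rewrite rl gr scalerDr !scalerA mulrC.
Qed.

(** The associator with its last factor x held fixed. It is defined on all of K (x) T because [th']
    sends an element of P to a sum of pure tensors in general. *)
Definition unbracket_elim (X Y Z : C) (f : hom X Y) (g : hom Y Z) (h : hom X Z)
    (e : g \oc f = h) (x : B _ _ g) :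
    {linear gtensor K T X Y f -> gtensor K (gtensor T B) X Z h} :=
  gtensor_elim (unbracket_pure_bilin e x).

Lemma unbracket_elim_linear X Y Z f g h e w :
  linear (fun x => @unbracket_elim X Y Z f g h e x w).
Proof.
apply: gtensor_elim_linear => F a t c x x'.
have [_ gr] := gtens_bilin K (gtensor T B) (comp_ract e F).
have [_ rr] := gtens_bilin T B (erefl (g \oc fsnd F)).
by rewrite /unbracket_pure rr gr scalerDr !scalerA mulrC.
Qed.

Lemma unbracket_elimE (W X Y Z : C) (f : hom W X) (g : hom X Y) (h : hom Y Z)
    (gf : hom W Y) (hg : hom X Z) (l : hom W Z)
    (e1 : g \oc f = gf) (e2 : h \oc gf = l)
    (e3 : h \oc g = hg) (e4 : hg \oc f = l) a t x :
  unbracket_elim e2 x (gtens e1 a t)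
  = uval (al _ _ _ _ f g h) *: gtens e4 a (gtens e3 t x).
Proof.
rewrite /unbracket_elim gtensor_elimE /unbracket_pure /=; destruct e3.
by rewrite (Prop_irrelevance e4 (comp_ract e2 (Factorization e1))).
Qed.

Lemma unbracket_bilin (X Y Z : C) (f : hom X Y) (g : hom Y Z) (h : hom X Z)
    (e : g \oc f = h) :
  bilin (fun p x => unbracket_elim e x (th' _ _ f p)).
Proof.
split=> [x c p p'|p c x x']; first by rewrite !linearP.
exact: unbracket_elim_linear.
Qed.

Definition unbracket : gmap (gtensor P B) (gtensor K (gtensor T B)) :=
  GMap (fun X Y h => gtensor_elim (fun F : factorization h =>
    unbracket_bilin (factorizationE F))).

Lemma unbracketE (X Y Z : C) (f : hom X Y) (g : hom Y Z) (h : hom X Z)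
    (e : g \oc f = h) p x :
  unbracket _ _ h (gtens e p x) = unbracket_elim e x (th' _ _ f p).
Proof.
by rewrite /unbracket gtensor_elimE; congr (unbracket_elim _ _ _).
Qed.

End Right.

Variables (th : gmap (gtensor K T) P) (th' : gmap P (gtensor K T)).

Lemma rebracketK : (forall X Y (f : hom X Y), cancel (th _ _ f) (th' _ _ f)) ->
  forall X Y (f : hom X Y), cancel (rebracket th _ _ f) (unbracket th' _ _ f).
Proof.
move=> thK X Z l w.
apply: (@gtensor_ext _ _ _ _ _ _ _ _ (unbracket th' _ _ l \o rebracket th _ _ l)
  idfun) => {w} Y f hg e4 a y /=.
(* The second factor y lies in T (x) B, so it has to be reduced to pure tensors in turn. *)
move: y; apply: (@gtensor_ext _ _ _ _ _ _ _ _
  (unbracket th' _ _ l \o glinr (rebracket th) e4 a)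
  (mk_linear ((gtens_bilin K (gtensor T B) e4).2 a))) => V g h e3 t x /=.
have e2 : h \oc (g \oc f) = l by rewrite compmA e3.
rewrite (rebracketE th erefl e2 e3 e4) linearZ_LR unbracketE thK.
rewrite (unbracket_elimE erefl e2 e3 e4).
by rewrite [LHS]scalerA alVl scale1r.
Qed.

Lemma unbracketK : (forall X Y (f : hom X Y), cancel (th' _ _ f) (th _ _ f)) ->
  forall X Y (f : hom X Y), cancel (unbracket th' _ _ f) (rebracket th _ _ f).
Proof.
move=> thK X Z l w.
apply: (@gtensor_ext _ _ _ _ _ _ _ _ (rebracket th _ _ l \o unbracket th' _ _ l)
  idfun) => {w} Y gf h e2 p x /=.
(* Writing p as [th] of w = [th' p] makes both sides linear in w, which can then be taken to be a
   pure tensor. *)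
rewrite unbracketE -[in RHS](thK _ _ _ p); move: (th' _ _ _ p) => w {p}.
move: w; apply: (@gtensor_ext _ _ _ _ _ _ _ _
  (rebracket th _ _ l \o unbracket_elim e2 x)
  (mk_linear ((gtens_bilin P B e2).1 x) \o th _ _ gf)) => V f g e1 a t /=.
have e4 : (h \oc g) \oc f = l by rewrite -compmA e1.
rewrite (unbracket_elimE e1 e2 erefl e4) linearZ_LR.
rewrite -[rebracket _ _ _ _ _]/(gact (rebracket th) e4 a (gtens erefl t x)).
by rewrite (rebracketE th e1 e2 erefl e4) [LHS]scalerA alV scale1r.
Qed.

End Rebracket.

Section LeftModules.
Variables (A : galgebra al) (N : gmod k C) (rho : gmap (gtensor A N) N).
Variable M : bimodule A A.

Definition left_linear (G : gmap N M) := forall (X Y Z : C)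
  (f : hom X Y) (g : hom Y Z) (h : hom X Z) (e : g \oc f = h)
  (a : A _ _ f) (t : N _ _ g),
  G _ _ h (gact rho e a t) = gact (lact M) e a (G _ _ g t).

(** * From left-linear maps on N to bimodule maps on N (x) A *)

Section RightExtension.

Lemma ract_ext_bilin (G : gmap N M) (X Y Z : C) (f : hom X Y) (g : hom Y Z)
    (h : hom X Z) (e : g \oc f = h) :
  bilin (fun t x => gact (ract M) e (G _ _ f t) x).
Proof.
have [bl br] := gact_bilin (ract M) e.
by split=> [x c t t'|t c x x']; rewrite ?linearP ?bl ?br.
Qed.

Definition ract_ext (G : gmap N M) : gmap (gtensor N A) M :=
  GMap (fun X Y h => gtensor_elim (fun F : factorization h =>
    ract_ext_bilin G (factorizationE F))).

Lemma ract_extE G (X Y Z : C) (f : hom X Y) (g : hom Y Z) (h : hom X Z)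
    (e : g \oc f = h) t x :
  ract_ext G _ _ h (gtens e t x) = gact (ract M) e (G _ _ f t) x.
Proof.
by rewrite /ract_ext gtensor_elimE; congr (gact _ _ _ _).
Qed.

(** Evaluation at t (x) 1; the scalar undoes the right unitor constant by which 1 acts on M. *)
Definition ract_restr (F : gmap (gtensor N A) M) : gmap N M :=
  GMap (fun X Y f => uinv (al _ _ _ _ f (idm Y) (idm Y)) \*:
    (F _ _ f \o mk_linear ((gtens_bilin N A (comp1m f)).1 (one A Y)))).

Lemma ract_restrE F (X Y : C) (f : hom X Y) (e : idm Y \oc f = f) t :
  ract_restr F _ _ f t
  = uinv (al _ _ _ _ f (idm Y) (idm Y)) *: F _ _ f (gtens e t (one A Y)).
Proof. by rewrite /=; congr (_ *: F _ _ _ (gtens _ _ _)); exact: Prop_irrelevance. Qed.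

(** Commuting the two actions of M costs al(|a|, |t|, |x|), which cancels the inverse coefficient in
    [tens_lact]. *)
Lemma ract_ext_lact G : left_linear G ->
  forall (X Y Z : C) (f : hom X Y) (g : hom Y Z) (h : hom X Z) (e : g \oc f = h)
    (a : A _ _ f) m,
  ract_ext G _ _ h (gact (tens_lact rho) e a m)
  = gact (lact M) e a (ract_ext G _ _ g m).
Proof.
move=> GL X Y Z f g h e a.
apply: (@gtensor_ext _ _ _ _ _ _ _ _ (ract_ext G _ _ h \o glinr (tens_lact rho) e a)
  (glinr (lact M) e a \o ract_ext G _ _ g)) => V p q e' t x /=.
have E : q \oc (p \oc f) = h by rewrite compmA e'.
rewrite (tens_lactE rho erefl E e' e) linearZ_LR !ract_extE GL.
by rewrite (lractA erefl E e' e) [LHS]scalerA alVl scale1r.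
Qed.

Lemma ract_ext_ract G :
  forall (X Y Z : C) (f : hom X Y) (g : hom Y Z) (h : hom X Z) (e : g \oc f = h)
    m (b : A _ _ g),
  ract_ext G _ _ h (gact (tens_ract A N) e m b)
  = gact (ract M) e (ract_ext G _ _ f m) b.
Proof.
move=> X Y Z f g h e m b; move: m.
apply: (@gtensor_ext _ _ _ _ _ _ _ _ (ract_ext G _ _ h \o glinl (tens_ract A N) e b)
  (glinl (ract M) e b \o ract_ext G _ _ f)) => V p q e' t x /=.
have E : (g \oc q) \oc p = h by rewrite -compmA e'.
rewrite (tens_ractE e' e erefl E) linearZ_LR !ract_extE.
by rewrite (ractA e' e erefl E).
Qed.

(** Acting by a on t (x) 1 costs al(|a|, |t|, Id)^-1; by [runitor_coef_comp] this is the ratio of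
    the normalising scalars in degrees |t| and |a . t|. *)
Lemma ract_restr_left_linear (F : gmap (gtensor N A) M) :
  (forall (X Y Z : C) (f : hom X Y) (g : hom Y Z) (h : hom X Z) (e : g \oc f = h)
    (a : A _ _ f) m,
    F _ _ h (gact (tens_lact rho) e a m) = gact (lact M) e a (F _ _ g m)) ->
  left_linear (ract_restr F).
Proof.
move=> FL X Y Z f g h e a t.
rewrite (ract_restrE F (comp1m h)) (ract_restrE F (comp1m g)) gactZr -FL.
rewrite (tens_lactE rho e (comp1m h) (comp1m g) e) linearZ_LR scalerA.
congr (_ *: _); destruct e; have E := runitor_coef_comp f g.
rewrite /runitor_coef in E.
apply: (@uval_mulI (al _ _ _ _ (g \oc f) (idm Z) (idm Z))).
rewrite /= alV E; set a1 := al _ _ _ _ f g _; set a2 := al _ _ _ _ g _ _.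
transitivity ((uval a1 * uinv a1) * (uval a2 * uinv a2)); last by ring.
by rewrite !uvalV mul1r.
Qed.

Lemma ract_extK G (X Y : C) (f : hom X Y) t :
  ract_restr (ract_ext G) _ _ f t = G _ _ f t.
Proof.
by rewrite (ract_restrE _ (comp1m f)) ract_extE ract1 scalerA alVl scale1r.
Qed.

(** Right linearity determines F: (t (x) 1) . x is t (x) x times al(|t|, Id, |x|) al(Id, Id,
    |x|)^-1, which by [al_triangle] is the right unitor constant that [ract_restr] divides out. *)
Lemma ract_restrK (F : gmap (gtensor N A) M) :
  (forall (X Y Z : C) (f : hom X Y) (g : hom Y Z) (h : hom X Z) (e : g \oc f = h)
    m (b : A _ _ g),
    F _ _ h (gact (tens_ract A N) e m b) = gact (ract M) e (F _ _ f m) b) ->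
  forall (X Y : C) (f : hom X Y), ract_ext (ract_restr F) _ _ f =1 F _ _ f.
Proof.
move=> FR X Z h; apply: gtensor_ext => Y f g e t x.
rewrite ract_extE (ract_restrE _ (comp1m f)) gactZl -FR.
rewrite (tens_ractE (comp1m f) e (compm1 g) e).
rewrite mul1x gtensZr 2!linearZ_LR !scalerA.
rewrite al_triangle /runitor_coef /lunitor_coef mulrA alVl mul1r alV.
exact: scale1r.
Qed.

End RightExtension.

(** * From graded maps on T to left-linear maps on the free module N *)

Section LeftExtension.
Variables (T : gmod k C) (th : gmap (gtensor A T) N) (th' : gmap N (gtensor A T)).

(* Together with th' being inverse to th, this makes N free on T. *)
Definition free_lact := forall (W X Y Z : C) (f : hom W X) (g : hom X Y) (h : hom Y Z)
    (gf : hom W Y) (hg : hom X Z) (l : hom W Z)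
    (e1 : g \oc f = gf) (e2 : h \oc gf = l)
    (e3 : h \oc g = hg) (e4 : hg \oc f = l) a a' t,
  gact th e2 (gact (mul A) e1 a a') t
  = uval (al _ _ _ _ f g h) *: gact rho e4 a (gact th e3 a' t).

Hypothesis thA : free_lact.
Hypothesis thK : forall X Y (f : hom X Y), cancel (th _ _ f) (th' _ _ f).
Hypothesis th'K : forall X Y (f : hom X Y), cancel (th' _ _ f) (th _ _ f).

Lemma lact_ext_bilin (g0 : gmap T M) (X Y Z : C) (f : hom X Y) (g : hom Y Z)
    (h : hom X Z) (e : g \oc f = h) :
  bilin (fun a t => gact (lact M) e a (g0 _ _ g t)).
Proof.
have [bl br] := gact_bilin (lact M) e.
by split=> [t c a a'|a c t t']; rewrite ?linearP ?bl ?br.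
Qed.

Definition lact_ext (g0 : gmap T M) : gmap N M :=
  GMap (fun X Y h => gtensor_elim (fun F : factorization h =>
    lact_ext_bilin g0 (factorizationE F)) \o th' _ _ h).

Lemma lact_extE g0 (X Y Z : C) (f : hom X Y) (g : hom Y Z) (h : hom X Z)
    (e : g \oc f = h) a t :
  lact_ext g0 _ _ h (gact th e a t) = gact (lact M) e a (g0 _ _ g t).
Proof.
rewrite /lact_ext /= /gact thK gtensor_elimE -/(gact _ _ _ _).
by congr (gact _ _ _ _).
Qed.

(** By [th'K] the map [th] is onto, so the images of pure tensors span N in each degree. *)
Lemma free_module_ext (X Y : C) (h : hom X Y) (W : lmodType k)
    (F G : {linear N _ _ h -> W}) :
  (forall (Z : C) (f : hom X Z) (g : hom Z Y) (e : g \oc f = h) a t,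
     F (gact th e a t) = G (gact th e a t)) -> F =1 G.
Proof.
move=> FG p; rewrite -(th'K p); move: (th' _ _ _ p).
apply: (@gtensor_ext _ _ _ _ _ _ _ _ (F \o th _ _ h) (G \o th _ _ h)).
by move=> Z f g e a t; exact: FG.
Qed.

Lemma lact_ext_left_linear g0 : left_linear (lact_ext g0).
Proof.
move=> X Y Z f g h e a.
apply: (@free_module_ext _ _ _ _ (lact_ext g0 _ _ h \o glinr rho e a)
  (glinr (lact M) e a \o lact_ext g0 _ _ g)) => V p q e' b t.
rewrite -[LHS]/(lact_ext g0 _ _ h (gact rho e a (gact th e' b t))).
rewrite -[RHS]/(gact (lact M) e a (lact_ext g0 _ _ g (gact th e' b t))).
have E : q \oc (p \oc f) = h by rewrite compmA e'.
(* [thA] gives the value of the extension on a . th(b, t) up to the factor al(f, p, q).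
   Associativity of M produces the same factor, and multiplying by its inverse removes both. *)
rewrite lact_extE; have /(congr1 (lact_ext g0 _ _ h)) := thA erefl E e' e a b t.
rewrite lact_extE linearZ_LR (lactA erefl E e' e).
move=> /(congr1 (fun z => uinv (al _ _ _ _ f p q) *: z)).
by rewrite !scalerA alVl !scale1r.
Qed.

(** Evaluation at 1 (x) t; the scalar is inverse to the left unitor constant by which 1 acts on
    M. *)
Definition lact_restr (G : gmap N M) : gmap T M :=
  GMap (fun X Y g => uval (al _ _ _ _ (idm X) (idm X) g) \*:
    (G _ _ g \o glinr th (compm1 g) (one A X))).

Lemma lact_extK g0 (X Y : C) (g : hom X Y) t :
  lact_restr (lact_ext g0) _ _ g t = g0 _ _ g t.
Proof.
rewrite -[LHS]/(_ *: lact_ext g0 _ _ g (gact th (compm1 g) (one A X) t)).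
by rewrite lact_extE lact1 scalerA alV scale1r.
Qed.

(** Computing th(a 1, t) in two ways gives R th(a, t) = al(|a|, Id, |t|) a . th(1, t), where R is
    the right unitor constant of |a|. By [al_triangle], R cancels and leaves exactly the scalar of
    [lact_restr]. *)
Lemma lact_restrK G : left_linear G ->
  forall (X Y : C) (f : hom X Y), lact_ext (lact_restr G) _ _ f =1 G _ _ f.
Proof.
move=> GL X Z h; apply: free_module_ext => Y f g e a t.
rewrite lact_extE [lact_restr G _ _ g t]/= gactZr -GL.
have /(congr1 (G _ _ h)) := thA (comp1m f) e (compm1 g) e a (one A Y) t.
rewrite mulx1 gactZl !linearZ_LR al_triangle /=.
move=> /(congr1 (fun z => uinv (al _ _ _ _ f (idm Y) (idm Y)) *: z)).
by rewrite !scalerA mulrA alVl mul1r scale1r.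
Qed.

End LeftExtension.
End LeftModules.

(** * Freeness of the tensor powers of A as left modules *)

Section TensorPowers.
Variable A : galgebra al.

Definition gid (K : gmod k C) : gmap K K := GMap (fun _ _ _ => idfun).

(* tpow A 1 is A rather than I_C (x) A, hence the separate case n = 1. *)
Fixpoint tpow_free (n : nat) : gmap (gtensor A (tpow A n)) (tpow A n.+1) :=
  match n with
  | 0 => unit_ract A (@runitor_coef _ _ al)
  | n'.+1 => match n' return gmap (gtensor A (tpow A n')) (tpow A n'.+1) ->
                    gmap (gtensor A (tpow A n'.+1)) (tpow A n'.+2) with
             | 0 => fun _ => gid (gtensor A A)
             | _.+1 => fun th => rebracket A th
             end (tpow_free n')
  end.

(** The inverse of the right unitor A (x) I_C -> A. *)
Definition unit_free_inv : gmap A (gtensor A (gunit k C)) :=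
  GMap (fun X Y f => uinv (al _ _ _ _ f (idm Y) (idm Y)) \*:
    mk_linear ((gtens_bilin A (gunit k C) (comp1m f)).1 (gone k Y))).

Fixpoint tpow_free_inv (n : nat) : gmap (tpow A n.+1) (gtensor A (tpow A n)) :=
  match n with
  | 0 => unit_free_inv
  | n'.+1 => match n' return gmap (tpow A n'.+1) (gtensor A (tpow A n')) ->
                    gmap (tpow A n'.+2) (gtensor A (tpow A n'.+1)) with
             | 0 => fun _ => gid (gtensor A A)
             | _.+1 => fun th' => unbracket A th'
             end (tpow_free_inv n')
  end.

Lemma tpow_free_lact n : free_lact (tpow_lact A n) (tpow_free n).
Proof.
elim: n => [|[_|n IH]] W X Y Z f g h gf hg l e1 e2 e3 e4 a a' t.
(* n = 0: t may be taken to be a scalar in an identity degree, and [runitor_coef_comp] compares the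
   two unitor constants. *)
- have [->|[w [c ->]]] := gunitP t; first by rewrite !gact0r scaler0.
  destruct w; have E := etrans (esym (comp1m _)) e3; destruct E.
  have E := etrans (esym (comp1m _)) e2; destruct E.
  rewrite /= !unit_ractE gactZr scalerA.
  rewrite (Prop_irrelevance e4 e1); congr (_ *: _).
  by destruct e1; rewrite runitor_coef_comp; ring.
(* n = 1: [tpow_free] is the identity, and al cancels the inverse coefficient of the left action on
   A (x) A. *)
- rewrite /= (tens_lactE (mul A) e1 e2 e3 e4).
  by rewrite scalerA alV scale1r.
move: t; apply: (@gtensor_ext _ _ _ _ _ _ _ _ (glinr (tpow_free n.+2) e2 _)
  (uval (al _ _ _ _ f g h) \*:
    (glinr (tpow_lact A n.+2) e4 a \o glinr (tpow_free n.+2) e3 a'))).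
move=> V p q e t x /=.
have E1 : q \oc (p \oc gf) = l by rewrite compmA e.
have E2 : (p \oc g) \oc f = p \oc gf by rewrite -compmA e1.
have E3 : q \oc (p \oc g) = hg by rewrite compmA e.
have E := rebracketE (tpow_free n.+1).
rewrite (E _ _ _ _ _ _ _ _ _ _ _ erefl E1 e e2).
rewrite (IH _ _ _ _ _ _ _ _ _ _ e1 erefl erefl E2).
rewrite (E _ _ _ _ _ _ _ _ _ _ _ erefl E3 e e3) gactZr.
rewrite (tens_lactE (tpow_lact A n.+1) E2 E1 E3 e4).
rewrite gtensZl !scalerA; congr (_ *: _).
destruct e, e1.
(* For larger powers the coefficients agree by the cocycle condition at (|a|, |a'|, |t|, |x|), as in
   [tens_lactA]. *)
by have [-> _ _] := cocycle_coefs (assoc_cocycle al f g p q); ring.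
Qed.

Lemma tpow_freeK n (X Y : C) (f : hom X Y) :
  cancel (tpow_free n _ _ f) (tpow_free_inv n _ _ f).
Proof.
elim: n X Y f => [|[//|n IH]]; last exact: rebracketK IH.
move=> X Y h w.
apply: (@gtensor_ext _ _ _ _ _ _ _ _ (tpow_free_inv 0 _ _ h \o tpow_free 0 _ _ h)
  idfun) => {w} Z f g e a t.
have [->|[w [c ->]]] := gunitP t.
  by rewrite (bilin0r (gtens_bilin _ _ _)) !linear0.
destruct w; have E := etrans (esym (comp1m _)) e; destruct E.
rewrite [LHS]/= -/(gact (unit_ract A (@runitor_coef _ _ al)) e a _) unit_ractE.
rewrite -[LHS]/(uinv (al _ _ _ _ f (idm _) (idm _)) *:
  gtens (comp1m f) ((c * runitor_coef al f) *: a) (gone k _)).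
rewrite gtensZl [LHS]scalerA mulrCA alVl mulr1 (Prop_irrelevance e (comp1m f)).
(* The scalar c moves across the tensor sign, back to the unit it came from. *)
rewrite -gtensZr; congr (gtens _ _ _).
by rewrite -(linearZ_LR (@dinj k _ (fun=> k^o) (IsId _))) [_ *: _]mulr1.
Qed.

Lemma tpow_free_invK n (X Y : C) (f : hom X Y) :
  cancel (tpow_free_inv n _ _ f) (tpow_free n _ _ f).
Proof.
elim: n X Y f => [|[//|n IH]]; last exact: unbracketK IH.
move=> X Y f a.
rewrite [tpow_free_inv _ _ _ _ _]/= linearZ_LR.
rewrite -[tpow_free _ _ _ _ _]/(gact (unit_ract A (@runitor_coef _ _ al)) (comp1m f) a _).
by rewrite unit_ractE mul1r scalerA alVl scale1r.
Qed.

End TensorPowers.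

(** * Graded maps as morphisms of (I_C, I_C)-bimodules *)

Section UnitBimodules.
Variables (K L : gmod k C) (F : gmap K L).

(** I_C acts through scalars that depend only on the degree, and F is linear and preserves
    degrees. *)
Lemma unit_bimodule_lact :
  @commutes_lact _ _ al _ _ (unit_bimodule al K) (unit_bimodule al L) F.
Proof.
move=> X Y Z f g h e a m.
have [->|[w [c ->]]] := gunitP a; first by rewrite !gact0l linear0.
destruct w; have E := etrans (esym (compm1 _)) e; destruct E.
by rewrite /= /unitor_lact !unit_lactE linearZ_LR.
Qed.

Lemma unit_bimodule_ract :
  @commutes_ract _ _ al _ _ (unit_bimodule al K) (unit_bimodule al L) F.
Proof.
move=> X Y Z f g h e m b.
have [->|[w [c ->]]] := gunitP b; first by rewrite !gact0r linear0.
destruct w; have E := etrans (esym (comp1m _)) e; destruct E.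
by rewrite /= /unitor_ract !unit_ractE linearZ_LR.
Qed.

Definition unit_bimhom : bimhom (unit_bimodule al K) (unit_bimodule al L) :=
  Bimhom unit_bimodule_lact unit_bimodule_ract.

End UnitBimodules.

(** * The two mutually inverse correspondences *)

Section Adjunction.
Variables (A : galgebra al) (M : bimodule A A) (n : nat).

Definition tpow_ext (g : gmap (tpow A n) M) : bimhom (tpow_bimodule A n) M :=
  @Bimhom _ _ _ _ _ (tpow_bimodule A n) M (ract_ext (lact_ext (tpow_free_inv A n) g))
    (ract_ext_lact (lact_ext_left_linear (@tpow_free_lact A n)
       (@tpow_freeK A n) (@tpow_free_invK A n) g))
    (@ract_ext_ract _ _ _ _).

Definition tpow_restr (F : bimhom (tpow_bimodule A n) M) : gmap (tpow A n) M :=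
  lact_restr (tpow_free A n) (ract_restr F).

Lemma tpow_restr_linear c F G (X Y : C) (f : hom X Y) t :
  tpow_restr (c *: F + G) _ _ f t
  = c *: tpow_restr F _ _ f t + tpow_restr G _ _ f t.
Proof.
rewrite /tpow_restr /= [uinv _ *: (_ + _)]scalerDr scalerDr !scalerA.
by rewrite [c * _]mulrC.
Qed.

Lemma tpow_restrK F : tpow_ext (tpow_restr F) = F.
Proof.
(* F is recovered in two stages: left linearity of F first gives back its restriction to A^{n+1},
   then right linearity gives back F. *)
have E : lact_ext (tpow_free_inv A n) (tpow_restr F) = ract_restr F.
  apply: gmap_eq => X Y f; apply: (lact_restrK (@tpow_free_lact A n)
    (@tpow_freeK A n) (@tpow_free_invK A n)).
  exact: ract_restr_left_linear (bim_mapL F).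
apply: bimhomP => X Y f x.
rewrite -[LHS]/(ract_ext (lact_ext (tpow_free_inv A n) (tpow_restr F)) _ _ f x) E.
exact: (ract_restrK (bim_mapR F)).
Qed.

Lemma tpow_extK g : tpow_restr (tpow_ext g) = g.
Proof.
have E : ract_restr (tpow_ext g) = lact_ext (tpow_free_inv A n) g.
  by apply: gmap_eq => X Y f x; exact: ract_extK.
rewrite /tpow_restr E; apply: gmap_eq => X Y f t.
exact: (lact_extK (@tpow_freeK A n)).
Qed.

End Adjunction.
End FreeBimodules.

Theorem theorem4p5 (k : comPzRingType) (C : category) (al : grading k C)
    (A : galgebra al) (M : bimodule A A) (n : nat) :
  exists phi : {linear bimhom (unit_bimodule al (tpow A n)) (unit_bimodule al M)
                       -> bimhom (tpow_bimodule A n) M},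
    bijective phi.
Proof.
pose I N := unit_bimodule al N.
pose psi (F : bimhom (tpow_bimodule A n) M) : bimhom (I (tpow A n)) (I M) :=
  unit_bimhom al (tpow_restr F).
pose phi (g : bimhom (I (tpow A n)) (I M)) := tpow_ext g.
have psiK : cancel psi phi by move=> F; exact: tpow_restrK.
have phiK : cancel phi psi.
  move=> g; apply: bimhomP => X Y f t.
  by rewrite -[LHS]/(tpow_restr (tpow_ext g) _ _ f t) tpow_extK.
(* Linearity is checked after the injective map [psi], which only evaluates at units and is
   therefore visibly linear. *)
have lphi : linear phi.
  move=> c F G; apply: (can_inj psiK); rewrite phiK; apply: bimhomP => X Y f t.
  rewrite -[RHS]/(tpow_restr (c *: phi F + phi G) _ _ f t) tpow_restr_linear.
  by rewrite !tpow_extK.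
by exists (mk_linear lphi); exists psi.
Qed.
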